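(* Let $d\in\mathbb{N}$, $1\le p\le\infty$, and let $w_\alpha$ be the Jacobi weight on the simplex $S\subset\mathbb{R}^d$ with parameters $\alpha=(\alpha_1,\dots,\alpha_{d+1})$, $\alpha_i>-1$ for $i=1,\dots,d+1$. Set $\rho:=d+\sum_{i=1}^{d+1}\alpha_i$. Then for all $f\in L_{p,w_\alpha}(S)$ and all $n\in\mathbb{N}$ (with $n\ge 1$) $$ K_\alpha(f,n^{-1})_p\le \left(4+\frac{2\rho}{n}\right)\big(\|M_{n,\alpha}f-f\|_{p,w_\alpha}+\|M_{2n,\alpha}f-f\|_{p,w_\alpha}\big)+\frac{4}{n}\sum_{k=n+1}^{2n}\|M_{k,\alpha}f-f\|_{p,w_\alpha}. $$
   Context: For $x=(x_1,\dots,x_d)\in\mathbb{R}^d$ write $|x|:=\sum_{i=1}^d x_i$ (used for $x\in S$ and for multi-indices). The standard simplex is $S:=\{x\in\mathbb{R}^d: x_i\ge 0,\ i=1,\dots,d,\ |x|\le 1\}$. Jacobi weight: $w_\alpha(x):=x_1^{\alpha_1}\cdots x_d^{\alpha_d}(1-|x|)^{\alpha_{d+1}}$. Spaces: for $1\le p<\infty$, $L_{p,w_\alpha}(S)$ is the space of Lebesgue measurable $f$ on $S$ with $\|f\|_{p,w_\alpha}:=\left(\int_S|f(x)|^p w_\alpha(x)\,dx\right)^{1/p}<\infty$; for $p=\infty$, $L_{\infty,w_\alpha}(S):=L_\infty(S)$ with $\|f\|_{\infty,w_\alpha}:=\mathrm{ess\,sup}_{x\in S}|f(x)|$. Bernstein-Durrmeyer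 operators: for $n\in\mathbb{N}_0$ and $\mathbf{k}=(k_1,\dots,k_d)\in\mathbb{N}_0^d$ with $|\mathbf{k}|\le n$ let $$p_{n,\mathbf{k}}(x):=\frac{n!}{k_1!\cdots k_d!\,(n-|\mathbf{k}|)!}\prod_{i=1}^d x_i^{k_i}\,(1-|x|)^{n-|\mathbf{k}|},$$ $$M_{n,\alpha}f(x):=\sum_{|\mathbf{k}|\le n}p_{n,\mathbf{k}}(x)\left(\int_S p_{n,\mathbf{k}}(y)w_\alpha(y)\,dy\right)^{-1}\int_S f(y)p_{n,\mathbf{k}}(y)w_\alpha(y)\,dy.$$ Differential operator: $$P_\alpha(D):=\sum_{\xi\in E_S}w_\alpha(x)^{-1}\frac{\partial}{\partial\xi}\,\tilde d(\xi,x)\,w_\alpha(x)\,\frac{\partial}{\partial\xi},$$ i.e. $P_\alpha(D)g=\sum_{\xi\in E_S}w_\alpha^{-1}\,\partial_\xi\big(\tilde d(\xi,\cdot)\,w_\alpha\,\partial_\xi g\big)$, where $E_S$ is the set of directions (unit vectors, one for each edge of $S$, the choice of sign being immaterial) parallel to the edges of $S$, and $$\tilde d(\xi,x):=\sup_{\lambda\ge 0,\ x+\lambda\xi\in S}d(x,x+\lambda\xi)\cdot\sup_{\lambda\ge 0,\ x-\lambda\xi\in S}d(x,x-\lambda\xi),$$ with $d(x,y)$ the Euclidean distance. $K$-functional: for $t>0$, $$K_\alpha(f,t)_p:=\inf_{g\in C^2(S)}\left\{\|f-g\|_{p,w_\alpha}+t\,\|P_\alpha(D)g\|_{p,w_\alpha}\right\}.$$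 *)

(* Defs.v *)
From HB Require Import structures.
From mathcomp Require Import all_boot all_order all_algebra.
From mathcomp Require Import all_classical all_reals all_analysis.
From mathcomp Require Import ess_sup_inf.

Set Implicit Arguments.
Unset Strict Implicit.
Unset Printing Implicit Defensive.

Import Order.TTheory GRing.Theory Num.Theory.
Import numFieldNormedType.Exports.

Local Open Scope classical_set_scope.
Local Open Scope ring_scope.

(* Lebesgue measure on R^d: the iterated product measure is built on Borel
   tuples, transported to 'rV[R]_d as an outer measure, and restricted to its
   Caratheodory (= Lebesgue) measurable sets. *)

Section cons_measure.
Context {R : realType} (n : nat).
Let B := measurableTypeR R.
Variable mu : {sigma_finite_measure set (n.-tuple B) -> \bar R}.

Definition tuple_cons (x : B * n.-tuple B) : n.+1.-tuple B :=
  [the n.+1.-tuple B of x.1 :: x.2].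

Lemma measurable_tuple_cons : measurable_fun [set: B * n.-tuple B] tuple_cons.
Proof. exact: measurable_cons. Qed.

Definition cons_measure : set (n.+1.-tuple B) -> \bar R :=
  pushforward (@lebesgue_measure R \x mu)%E tuple_cons.

Let cons_measure0 : cons_measure set0 = 0%E.
Proof. by rewrite /cons_measure /pushforward preimage_set0 measure0. Qed.

Let cons_measure_ge0 A : (0 <= cons_measure A)%E.
Proof. by rewrite /cons_measure /pushforward measure_ge0. Qed.

Let cons_measure_sigma_additive : semi_sigma_additive cons_measure.
Proof.
move=> F mF tF mUF; rewrite /cons_measure /pushforward preimage_bigcup.
have mcons A : measurable A -> measurable (tuple_cons @^-1` A).
  by move=> mA; rewrite -[X in measurable X]setTI; exact: measurable_tuple_cons.
apply: measure_semi_sigma_additive.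
- by move=> k; exact: mcons.
- apply/trivIsetP => i j _ _ ij; rewrite -preimage_setI.
  by move/trivIsetP : tF => -> //; rewrite preimage_set0.
- by rewrite -preimage_bigcup; exact: mcons.
Qed.

HB.instance Definition _ := isMeasure.Build _ _ _ cons_measure
  cons_measure0 cons_measure_ge0 cons_measure_sigma_additive.

Let sigma_finite_cons_measure : sigma_finite setT cons_measure.
Proof.
have /sigma_finiteP[F [TF ndF Foo]] := sigma_finiteT (@lebesgue_measure R).
have /sigma_finiteP[G [TG ndG Goo]] := sigma_finiteT mu.
pose uncons (t : n.+1.-tuple B) : B * n.-tuple B :=
  (thead t, [tuple of behead t]).
have consK : cancel tuple_cons uncons.
  by move=> [x t]; rewrite /uncons theadE; congr pair; exact: val_inj.
have muncons : measurable_fun [set: n.+1.-tuple B] uncons.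
  apply: measurable_fun_pair; first exact: measurable_tnth.
  exact: measurable_behead.
exists (fun k => uncons @^-1` (F k `*` G k)).
  rewrite -preimage_bigcup predeqE => t; split => // _.
  have [k _ Fk] : (\bigcup_k F k) (uncons t).1 by rewrite -TF.
  have [l _ Gl] : (\bigcup_k G k) (uncons t).2 by rewrite -TG.
  exists (maxn k l) => //; split.
    by move: Fk; exact/subsetPset/ndF/leq_maxl.
  by move: Gl; exact/subsetPset/ndG/leq_maxr.
move=> k; have [mF muF] := Foo k; have [mG muG] := Goo k; split.
  by rewrite -[X in measurable X]setTI; apply: muncons => //; exact: measurableX.
rewrite /cons_measure /pushforward -comp_preimage.
rewrite (_ : uncons \o tuple_cons = id); last first.
  by apply/funext => x; exact: consK.
rewrite preimage_id product_measure1E//.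
by rewrite lte_mul_pinfty// ge0_fin_numE.
Qed.

HB.instance Definition _ :=
  Measure_isSigmaFinite.Build _ _ _ cons_measure sigma_finite_cons_measure.

End cons_measure.

Fixpoint lebesgue_tuple {R : realType} (n : nat) :
    {sigma_finite_measure set (n.-tuple (measurableTypeR R)) -> \bar R} :=
  match n with
  | 0%N => (\d_ ([tuple] : 0.-tuple (measurableTypeR R)) : set _ -> \bar R)
  | m.+1 => cons_measure (lebesgue_tuple m)
  end.

Section lebesgue_rV.
Context {R : realType} {d : nat}.

Definition rV_of_tuple (t : d.-tuple (measurableTypeR R)) : 'rV[R]_d :=
  \row_i tnth t i.

Definition lebesgue_outer (A : set 'rV[R]_d) : \bar R :=
  mu_ext (lebesgue_tuple d) (rV_of_tuple @^-1` A).

Let lebesgue_outer0 : lebesgue_outer set0 = 0%E.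
Proof. by rewrite /lebesgue_outer preimage_set0 outer_measure0. Qed.

Let lebesgue_outer_ge0 A : (0 <= lebesgue_outer A)%E.
Proof. exact: outer_measure_ge0. Qed.

Let le_lebesgue_outer :
  {homo lebesgue_outer : A B / A `<=` B >-> (A <= B)%E}.
Proof.
by move=> A B AB; apply: le_outer_measure; exact: preimage_subset.
Qed.

Let lebesgue_outer_sigma_subadditive : sigma_subadditive lebesgue_outer.
Proof.
move=> F; rewrite /lebesgue_outer preimage_bigcup.
exact: outer_measure_sigma_subadditive.
Qed.

HB.instance Definition _ := isOuterMeasure.Build R 'rV[R]_d lebesgue_outer
  lebesgue_outer0 lebesgue_outer_ge0 le_lebesgue_outer
  lebesgue_outer_sigma_subadditive.

Definition lebesgue_outer_measure : {outer_measure set 'rV[R]_d -> \bar R} :=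
  lebesgue_outer.

Definition euclid : measurableType _ :=
  caratheodory_type lebesgue_outer_measure.

Definition lebesgue_rV : {measure set euclid -> \bar R} :=
  (lebesgue_outer_measure : set (caratheodory_type lebesgue_outer_measure) -> _).

End lebesgue_rV.
Arguments euclid : clear implicits.

Section simplex.
Context {R : realType} {d : nat}.
Implicit Types (x y xi : 'rV[R]_d) (f g : 'rV[R]_d -> R).

Definition coord_sum x : R := \sum_i x 0 i.

Definition simplex : set 'rV[R]_d :=
  [set x : 'rV[R]_d | (forall i, 0 <= x 0 i) /\ coord_sum x <= 1].

Definition euclid_norm x : R := Num.sqrt (\sum_i x 0 i ^+ 2).

Definition euclid_dist x y : R := euclid_norm (x - y).

(* The vertices of the simplex: the origin, then the unit vectors. *)
Definition simplex_vertex (i : 'I_d.+1) : 'rV[R]_d :=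
  \row_j (i == lift ord0 j)%:R.

Definition edge_direction (i j : 'I_d.+1) : 'rV[R]_d :=
  (euclid_dist (simplex_vertex i) (simplex_vertex j))^-1 *:
    (simplex_vertex i - simplex_vertex j).

(* The supremum is a real one: it is meaningful for x in the simplex and
   xi != 0, where the set is nonempty and bounded. *)
Definition reach xi x : R :=
  sup [set euclid_dist x (x + l *: xi) | l in
        [set l : R | 0 <= l /\ simplex (x + l *: xi)]].

Definition dtilde xi x : R := reach xi x * reach (- xi) x.

(* C^2 of the closed simplex: the partial derivatives of order at most 2 exist
   in the interior and extend continuously to the whole simplex. *)
Definition C2_simplex : set ('rV[R]_d -> R) :=
  [set g : 'rV[R]_d -> R |
    [/\ {within simplex, continuous g},
        forall i, exists2 h : 'rV[R]_d -> R,
          {within simplex, continuous h} &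
          forall x, interior simplex x -> is_derive x (delta_mx 0 i) g (h x) &
        forall i j, exists2 h : 'rV[R]_d -> R,
          {within simplex, continuous h} &
          forall x, interior simplex x ->
            is_derive x (delta_mx 0 j) ('D_(delta_mx 0 i) g) (h x)]].

(* Multi-indices k with |k| <= n have coordinates at most n, so that they are
   represented by functions into 'I_n.+1. *)
Definition bernstein n (k : 'I_d -> nat) x : R :=
  n`!%:R / (\prod_i (k i)`! * (n - \sum_i k i)`!)%N%:R *
  (\prod_i x 0 i ^+ k i) * (1 - coord_sum x) ^+ (n - \sum_i k i)%N.

Section weighted.
Local Notation S := (simplex : set (euclid R d)).
Variable alpha : 'I_d.+1 -> R.

Definition jacobi_weight x : R :=
  (\prod_(i < d) x 0 i `^ alpha (widen_ord (leqnSn d) i)) *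
  (1 - coord_sum x) `^ alpha ord_max.

(* For p = +oo the restriction by 0 outside the simplex does not change the
   essential supremum over the simplex, as `|f| is nonnegative and the simplex
   has positive measure. *)
Definition wnorm (p : \bar R) f : \bar R :=
  match p with
  | q%:E => (\int[lebesgue_rV]_(x in S)
               (`|f x| `^ q * jacobi_weight x)%:E) `^ q^-1
  | +oo => ess_sup lebesgue_rV ((fun x => `|f x|%:E) \_ simplex)
  | -oo => 0
  end%E.

Definition weighted_Lp (p : \bar R) : set ('rV[R]_d -> R) :=
  [set f : 'rV[R]_d -> R |
    measurable_fun S (f : euclid R d -> R) /\ (wnorm p f < +oo)%E].

Definition bernstein_durrmeyer n f x : R :=
  \sum_(k : {ffun 'I_d -> 'I_n.+1} | (\sum_i k i <= n)%N)
    bernstein n (val \o k) x *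
    (\int[lebesgue_rV]_(y in S)
       (bernstein n (val \o k) y * jacobi_weight y))^-1 *
    \int[lebesgue_rV]_(y in S)
       (f y * bernstein n (val \o k) y * jacobi_weight y).

(* Pairs i < j of vertices enumerate the edges. The expression has its intended
   meaning in the interior of the simplex, the boundary being negligible. *)
Definition P_D g x : R :=
  \sum_(i < d.+1) \sum_(j < d.+1 | (i < j)%N)
    let xi := edge_direction i j in
    (jacobi_weight x)^-1 *
    'D_xi (fun y => dtilde xi y * jacobi_weight y * 'D_xi g y) x.

Definition K_functional (p : \bar R) f (t : R) : \bar R :=
  ereal_inf [set (wnorm p (f \- g)%R + t%:E * wnorm p (P_D g))%E |
              g in C2_simplex].

End weighted.
End simplex.

(* Main.v *)
Require Import Defs.
From mathcomp Require Import all_boot all_order all_algebra.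
From mathcomp Require Import all_classical all_reals all_analysis.
From mathcomp Require Import ess_sup_inf measurable_realfun.
From mathcomp Require Import ring lra.

Set Implicit Arguments.
Unset Strict Implicit.
Unset Printing Implicit Defensive.

Import Order.TTheory GRing.Theory Num.Theory.
Import numFieldNormedType.Exports.

Local Open Scope classical_set_scope.
Local Open Scope ring_scope.

(** The proof rests on one identity for the eigenstructure of the operators.  Write
    rho := d + |alpha|.  On the interior of the simplex,

      P(D) M_k f = k (k + rho) (M_(k-1) f - M_k f)              (k >= 1),

    so that dividing by k (k + rho) makes the left-hand sides telescope.  Let

      g := sum over n < k <= 2n of c_k M_k f,   c_k := C / (k (k + rho)),

    with C chosen such that the c_k sum to 1.  Then P(D) g = C (M_n f - M_2n f)
    and f - g = sum of c_k (f - M_k f), whence by the triangle inequality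

      K(f, 1/n) <= (C / n) (err n + err 2n) + sum of c_k err k.

    As k (k + rho) increases with k, each of the n terms 1 / (k (k + rho)) is at
    least 1 / (2n (2n + rho)), which gives C <= 2 (2n + rho); hence
    C / n <= 4 + 2 rho / n, and c_k <= 4 / n for k > n.

    The identity has two halves, both simplest in barycentric coordinates, where
    M_k f is the sum over |m| = k of (k! / m!) a_m x^m, with
    a_m := (integral of f x^m w) / (integral of x^m w).

    The differential half ([P_D_bpoly]): along an edge only two barycentric
    coordinates move, and there the weight, the factor dtilde and the monomials
    are all products of powers; summing over the edges yields

      P(D) x^m = sum_i m_i (m_i + alpha_i) x^(m - e_i) - |m| (|m| + rho) x^m.

    The integral half ([mass_incr]): integrating by parts along an edge direction,

      (|m| + rho + 1) * integral of x^(m + e_i) w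
        = (m_i + alpha_i + 1) * integral of x^m w.

    A shift of the summation index ([mindex_sum_shift]) combines the two, since
    the coordinates sum to 1 and therefore the integrals of f x^(m + e_i) w add up
    to the integral of f x^m w; the result is [P_D_bernstein_durrmeyer].  The rest
    transports integrals between the Lebesgue measure on row vectors and iterated
    integrals, proves that the mass of the weight is finite, that the boundary is
    negligible and that polynomials are C^2, and checks that the weighted norm is
    a seminorm, by Minkowski's inequality. *)

(** * Iterated integrals *)

Section tonelli.
Context {R : realType} (n : nat).
Local Notation B := (measurableTypeR R).
Local Notation mu := (@lebesgue_measure R).
Variable g : n.+1.-tuple B -> \bar R.
Hypotheses (mg : measurable_fun [set: n.+1.-tuple B] g) (g0 : forall t, (0 <= g t)%E).

Let mgc : measurable_fun setT (g \o @tuple_cons R n).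
Proof. apply: measurableT_comp; [exact: mg|exact: measurable_tuple_cons]. Qed.

Lemma integral_tuple_head :
  (\int[lebesgue_tuple n.+1]_t g t =
   \int[mu]_x \int[lebesgue_tuple n]_t g (tuple_cons (x, t)))%E.
Proof.
rewrite /= (@ge0_integral_pushforward _ _ _ _ _ _
  (@measurable_tuple_cons R n))//= preimage_setT.
by rewrite (fubini_tonelli1 (g \o @tuple_cons R n) mgc (fun z => g0 _)).
Qed.

(** The order in which the head coordinate is innermost is what allows an
    integration by parts in that coordinate. *)
Lemma integral_tuple_tail :
  (\int[lebesgue_tuple n.+1]_t g t =
   \int[lebesgue_tuple n]_t \int[mu]_x g (tuple_cons (x, t)))%E.
Proof.
rewrite integral_tuple_head.
exact: (fubini_tonelli (g \o @tuple_cons R n) mgc (fun z => g0 _)).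
Qed.

Lemma measurable_integral_head :
  measurable_fun setT (fun x => \int[lebesgue_tuple n]_t g (tuple_cons (x, t)))%E.
Proof.
exact: (measurable_fun_fubini_tonelli_F (g \o @tuple_cons R n) mgc (fun z => g0 _)).
Qed.

Lemma measurable_integral_tail :
  measurable_fun [set: n.-tuple B]
    (fun t => \int[mu]_x g (tuple_cons (x, t)))%E.
Proof.
exact: (measurable_fun_fubini_tonelli_G (g \o @tuple_cons R n) mgc (fun z => g0 _)).
Qed.
End tonelli.

Section bridge.
Context {R : realType} {d : nat}.
Local Notation B := (measurableTypeR R).

(** The inverse of [rV_of_tuple]; it is measurable and maps the Lebesgue measure
    on row vectors to the product measure, so Tonelli's theorem reaches integrals
    over row vectors through it. *)
Definition tuple_of_rV (x : euclid R d) : d.-tuple B := [tuple x 0 i | i < d].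

Lemma tuple_of_rVK (t : d.-tuple B) : tuple_of_rV (rV_of_tuple t) = t.
Proof. by apply: eq_from_tnth => i; rewrite tnth_mktuple mxE. Qed.

Lemma measurable_tuple_of_rV : measurable_fun setT tuple_of_rV.
Proof.
move=> _ A mA; rewrite setTI.
suff : caratheodory_measurable lebesgue_outer (tuple_of_rV @^-1` A) by [].
move=> X; rewrite /= /lebesgue_outer !preimage_setI.
have E Y : rV_of_tuple @^-1` (tuple_of_rV @^-1` Y) = Y.
  by apply/seteqP; split => t /=; rewrite tuple_of_rVK.
rewrite preimage_setC E.
(* Borel sets are Caratheodory measurable for the outer measure of the product measure. *)
have /(_ (rV_of_tuple @^-1` X)) := @sub_caratheodory _ _ _ (@lebesgue_tuple R d) A
  (@sub_gen_smallest _ _ _ _ mA).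
by rewrite E.
Qed.

Lemma lebesgue_rV_preimage (A : set (d.-tuple B)) : measurable A ->
  lebesgue_rV (tuple_of_rV @^-1` A) = lebesgue_tuple d A.
Proof.
move=> mA; rewrite /lebesgue_rV /= /lebesgue_outer.
rewrite -measurable_mu_extE//; congr (mu_ext _ _).
by apply/seteqP; split => t /=; rewrite tuple_of_rVK.
Qed.

Lemma integral_lebesgue_rV (g : d.-tuple B -> \bar R) :
  measurable_fun [set: d.-tuple B] g -> (forall t, 0 <= g t)%E ->
  (\int[lebesgue_rV]_x g (tuple_of_rV x) = \int[lebesgue_tuple d]_t g t)%E.
Proof.
move=> mg g0.
have := @ge0_integral_pushforward _ _ _ _ _ _ measurable_tuple_of_rV
  lebesgue_rV _ _ measurableT mg (fun t _ => g0 t).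
rewrite preimage_setT => <-.
apply: eq_measure_integral.
  exact: measurable_tuple_of_rV.
move=> mphi A mA _; exact: lebesgue_rV_preimage.
Qed.

End bridge.

(** * The one-dimensional beta integral *)

Section beta.
Context {R : realType}.
Local Notation mu := (@lebesgue_measure R).

Lemma is_derive_powR_subr (a r x : R) : x < a ->
  is_derive x 1 (fun y => (a - y) `^ r) (- (r * (a - x) `^ (r - 1))).
Proof.
move=> xa.
have H : is_derive (a - x) 1 (@powR R ^~ r) (r * (a - x) `^ (r - 1)).
  by apply: is_derive1_powR; rewrite subr_gt0.
have H2 : is_derive x 1 (fun y : R => a - y) (- 1).
  have -> : (fun y : R => a - y) = cst a - id by [].
  apply: is_derive_eq.
  by rewrite sub0r.
have := @is_derive1_comp R (@powR R ^~ r) (fun y => a - y) x _ _ H H2.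
by rewrite mulrN1.
Qed.

Lemma continuous_powR (r x : R) : 0 < x -> {for x, continuous (@powR R ^~ r)}.
Proof.
move=> x0; apply/differentiable_continuous/derivable1_diffP.
by have [] := is_derive1_powR r x0.
Qed.

Lemma continuous_powR_subr (a r x : R) : x < a ->
  {for x, continuous (fun y => (a - y) `^ r)}.
Proof.
move=> x0; apply/differentiable_continuous/derivable1_diffP.
by have [] := is_derive_powR_subr r x0.
Qed.

Lemma powR_itv_ibp (a s r u v : R) : 0 <= r -> 0 < u -> u < v -> v < a ->
  (\int[mu]_(x in `[u, v]) (x `^ s * (r * (a - x) `^ (r - 1)))%:E =
   \int[mu]_(x in `[u, v]) (s * x `^ (s - 1) * (a - x) `^ r)%:E -
     (v `^ s * (a - v) `^ r - u `^ s * (a - u) `^ r)%:E)%E.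
Proof.
move=> r0 u0 uv va.
have H1 x : x \in `[u, v] -> 0 < x.
  by rewrite in_itv/= => /andP[+ _]; exact: lt_le_trans.
have H2 x : x \in `[u, v] -> x < a.
  by rewrite in_itv/= => /andP[_ +]; move/le_lt_trans; apply.
have uI : u \in `[u, v] by rewrite in_itv/= lexx ltW.
have vI : v \in `[u, v] by rewrite in_itv/= lexx ltW.
have C (f : R -> R) : {in `[u, v], forall x, {for x, continuous f}} ->
    {within `[u, v], continuous f}.
  move=> cf; apply: continuous_in_subspaceT => x; rewrite inE/= => xI.
  exact: cf.
have L (f f' : R -> R) : {in `[u, v], forall x : R, is_derive x 1 f (f' x)} ->
    derivable_oo_LRcontinuous f u v.
  move=> df; have cf x : x \in `[u, v] -> {for x, continuous f}.
    by move=> /df[? _]; apply/differentiable_continuous/derivable1_diffP.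
  split.
  - by move=> x /subset_itv_oo_cc /df[].
  - exact/cvg_at_right_filter/cf.
  - exact/cvg_at_left_filter/cf.
have D1 : {in `[u, v], forall x : R, is_derive x 1 (@powR R ^~ s) (s * x `^ (s - 1))}.
  by move=> x /H1 x0; exact: is_derive1_powR.
have D2 : {in `[u, v], forall x : R, is_derive x 1 (fun y => (a - y) `^ r)
    (- (r * (a - x) `^ (r - 1)))}.
  by move=> x /H2 x0; exact: is_derive_powR_subr.
have C1 : {within `[u, v], continuous (fun x => s * x `^ (s - 1))}.
  apply: C => x /H1 x0; apply: continuousM; first exact: cst_continuous.
  exact: continuous_powR.
have C2 : {within `[u, v], continuous (fun x => - (r * (a - x) `^ (r - 1)))}.
  apply: C => x /H2 x0; apply: continuousN; apply: continuousM.
    exact: cst_continuous.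
  exact: continuous_powR_subr.
have E1 : {in `]u, v[, derive1 (@powR R ^~ s) =1 (fun x => s * x `^ (s - 1))}.
  by move=> x /subset_itv_oo_cc /D1 [_ <-]; rewrite derive1E.
have E2 : {in `]u, v[, derive1 (fun y : R => (a - y) `^ r) =1
    (fun x => - (r * (a - x) `^ (r - 1)))}.
  by move=> x /subset_itv_oo_cc /D2 [_ <-]; rewrite derive1E.
have := integration_by_parts uv C1 (L _ _ D1) E1 C2 (L _ _ D2) E2.
under eq_integral do rewrite mulrN EFinN.
rewrite integral_ge0N; last first.
  move=> x _; rewrite lee_fin mulr_ge0 ?powR_ge0// mulr_ge0 ?powR_ge0//.
by move=> H; rewrite -[LHS]oppeK H oppeB ?fin_num_adde_defr// addeC.
Qed.

(** The boundary terms of the integration by parts vanish because x^s (a - x)^r is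
    0 at both ends, s and r being positive.  One of the integrands may be singular
    there, so the ends are cut off and restored by monotone convergence. *)
Lemma powR_ibp (a s r : R) : 0 < s -> 0 < r ->
  (s%:E * \int[mu]_(x in `]0%R, a[) (x `^ (s - 1) * (a - x) `^ r)%:E =
   r%:E * \int[mu]_(x in `]0%R, a[) (x `^ s * (a - x) `^ (r - 1))%:E)%E.
Proof.
move=> s0 r0.
have [a0|a0] := leP a 0.
  by rewrite set_itv_ge ?integral_set0 ?mule0// bnd_simp -leNgt.
have m1 (p q : R) : measurable_fun [set: R] (fun x => (x `^ p * (a - x) `^ q)%:E).
  apply/measurable_EFinP; apply: measurable_funM; first exact: measurable_powR.
  apply: (measurableT_comp (@measurable_powR R q)).
  exact: measurable_funB.
have m2 (D : set R) (p q : R) : measurable_fun D (fun x => (x `^ p * (a - x) `^ q)%:E).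
  exact: measurable_funS (m1 p q).
have p0 (p q x : R) : (0 <= (x `^ p * (a - x) `^ q)%:E)%E.
  by rewrite lee_fin mulr_ge0 ?powR_ge0.
(* The shift by two makes every cut-off smaller than a / 2. *)
pose e n : R := a * @harmonic R n.+2.
pose I n := `[e n, a - e n]%classic.
have e0 n : 0 < e n by rewrite mulr_gt0 ?harmonic_gt0.
have e2 n : e n < a - e n.
  rewrite ltrBrDr -mulrDr -[ltRHS]mulr1 ltr_pM2l//.
  have : (n.+3%:R : R)^-1 < 2^-1 by rewrite ltf_pV2 ?posrE// ltr_nat.
  by rewrite -[@harmonic R n.+2]/((n.+3%:R)^-1); move: (n.+3%:R^-1 : R) => h hh; lra.
have ecvg : e n @[n --> \oo] --> 0.
  rewrite -[X in _ --> X](mulr0 a); apply: cvgMl_tmp.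
  have -> : (fun n => @harmonic R n.+2) = (fun n => harmonic (n + 2)%N) by apply/funext => n; rewrite addn2.
  by have := @cvg_harmonic R; rewrite -(cvg_shiftn 2).
have eD m n : (m <= n)%N -> e n <= e m.
  by move=> mn; rewrite ler_pM2l// lef_pV2 ?posrE// ler_nat.
have IU : \bigcup_n I n = `]0, a[%classic.
  apply/seteqP; split => x /=.
    move=> [n _]; rewrite /I/= !in_itv/= => /andP[h1 h2].
    by rewrite (lt_le_trans (e0 n) h1)/= (le_lt_trans h2)// ltrBlDr ltrDl.
  rewrite in_itv/= => /andP[x0 xa].
  have [n _ /(_ _ (leqnn n))/andP[h1 h2]] : \forall n \near \oo, (e n < x) && (e n < a - x).
    near=> n; apply/andP; split; near: n.
      by apply: (cvgr_lt _ ecvg).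
    by apply: (cvgr_lt _ ecvg); rewrite subr_gt0.
  exists n => //; rewrite /I/= in_itv/= (ltW h1)/= lerBrDl -lerBrDr; exact: ltW.
have nI : nondecreasing_seq I.
  move=> m n mn; apply/subsetPset => x; rewrite /I/= !in_itv/= => /andP[h1 h2].
  by rewrite (le_trans (eD _ _ mn) h1)/= (le_trans h2)// lerB// eD.
have H1 p q : (\int[mu]_(x in I n) (x `^ p * (a - x) `^ q)%:E @[n --> \oo] -->
    \int[mu]_(x in `]0%R, a[) (x `^ p * (a - x) `^ q)%:E)%E.
  rewrite -IU; apply: ge0_nondecreasing_set_cvg_integral => //.
  - by move=> i; exact: measurable_itv.
  - by move=> i; exact: m2.
pose bd n := (a - e n) `^ s * (e n) `^ r - (e n) `^ s * (a - e n) `^ r.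
have K n : (s%:E * \int[mu]_(x in I n) (x `^ (s - 1) * (a - x) `^ r)%:E - (bd n)%:E =
   r%:E * \int[mu]_(x in I n) (x `^ s * (a - x) `^ (r - 1))%:E)%E.
  rewrite -!ge0_integralZl_EFin ?(ltW s0) ?(ltW r0)//; try exact: m2; try exact: measurable_itv.
  have := @powR_itv_ibp a s r (e n) (a - e n) (ltW r0) (e0 n) (e2 n).
  rewrite ltrBlDr ltrDl => /(_ (e0 n)); rewrite subKr => E.
  under [in RHS]eq_integral do rewrite -EFinM mulrCA.
  under [in LHS]eq_integral do rewrite -EFinM mulrA.
  by rewrite E.
have P b : 0 < b -> e n `^ b @[n --> \oo] --> 0.
  by move=> b0; have /cvg_at_rightP := powR_cvg0 b0; apply.
have Q b : (a - e n) `^ b @[n --> \oo] --> a `^ b.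
  have H : a - e n @[n --> \oo] --> a.
    by rewrite -[X in _ --> X](subr0 a); apply: cvgB => //; exact: cvg_cst.
  exact: (cvg_comp _ _ H (@continuous_powR b a a0)).
have bd0 : (bd n)%:E @[n --> \oo] --> 0%E.
  apply/cvg_EFin; first exact: nearW.
  have -> : (0 : R) = a `^ s * 0 - 0 * a `^ r by rewrite mulr0 mul0r subrr.
  apply: cvgB; apply: cvgM; [exact: Q|exact: P|exact: P|exact: Q].
have L1 : (s%:E * \int[mu]_(x in I n) (x `^ (s - 1) * (a - x) `^ r)%:E - (bd n)%:E
   @[n --> \oo] --> s%:E * \int[mu]_(x in `]0%R, a[) (x `^ (s - 1) * (a - x) `^ r)%:E)%E.
  rewrite -[X in _ --> X]sube0; apply: cvgeB => //.
    by rewrite oppe0 fin_num_adde_defl.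
  have F : s%:E \is a fin_num by [].
  exact: (cvgeZl F (H1 (s - 1) r)).
have L2 : (s%:E * \int[mu]_(x in I n) (x `^ (s - 1) * (a - x) `^ r)%:E - (bd n)%:E
   @[n --> \oo] --> r%:E * \int[mu]_(x in `]0%R, a[) (x `^ s * (a - x) `^ (r - 1))%:E)%E.
  under eq_fun do rewrite K.
  have F : r%:E \is a fin_num by [].
  exact: (cvgeZl F (H1 s (r - 1))).
exact: (cvg_unique (@ereal_hausdorff R) L1 L2).
Unshelve. all: by end_near.
Qed.

End beta.

(** * Dirichlet integrals *)

Section tpow.
Context {R : realType}.
Local Notation mu := (@lebesgue_measure R).

Implicit Types r x : R.

(** Truncation makes the integrands vanish off the open simplex, so that no domain
    of integration has to be tracked, and makes [tpowD1] hold for every x. *)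
Definition tpow r x : R := if 0 < x then x `^ r else 0.

Lemma tpow_ge0 r x : 0 <= tpow r x.
Proof. by rewrite /tpow; case: ifP => // _; exact: powR_ge0. Qed.

Lemma tpowD1 r x : tpow (r + 1) x = x * tpow r x.
Proof.
rewrite /tpow; case: ifPn => [x0|]; last by rewrite mulr0.
by rewrite powRD ?(gt_eqF x0) ?implybT// powRr1 ?ltW// mulrC.
Qed.

Lemma tpow_le1 r x : 0 <= r -> x <= 1 -> tpow r x <= 1.
Proof.
move=> r0 x1; rewrite /tpow; case: ifP => // x0.
by apply: le_trans (ge0_ler_powR r0 _ _ x1) _; rewrite ?nnegrE ?powR1 ?(ltW x0).
Qed.

Lemma measurable_tpow r : measurable_fun [set: R] (tpow r).
Proof.
apply: measurable_fun_ifT => //; first exact: measurable_fun_ltr.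
Qed.

Lemma tpow_ibp (a s r : R) : 0 < s -> 0 < r ->
  (s%:E * \int[mu]_x (tpow (s - 1) x * tpow r (a - x))%:E =
   r%:E * \int[mu]_x (tpow s x * tpow (r - 1) (a - x))%:E)%E.
Proof.
have E p q : (\int[mu]_x (tpow p x * tpow q (a - x))%:E =
    \int[mu]_(x in `]0%R, a[) (x `^ p * (a - x) `^ q)%:E)%E.
  rewrite [RHS]integral_mkcond; apply: eq_integral => x _.
  rewrite patchE mem_setE in_itv/= /tpow subr_gt0.
  by case: (0 < x); case: (x < a); rewrite /= ?mul0r ?mulr0.
by rewrite !E; exact: powR_ibp.
Qed.
End tpow.

Section dirichlet.
Context {R : realType}.
Local Notation B := (measurableTypeR R).
Local Notation mu := (@lebesgue_measure R).

(** The density, up to normalisation, of the Dirichlet distribution with exponents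
    b on the coordinates and c on the slack, scaled to the simplex of size a.  The
    size is a parameter because fixing one coordinate x leaves a simplex of size
    a - x. *)
Definition dirichlet_density d (b : 'I_d -> R) (c a : R) (t : d.-tuple B) : R :=
  (\prod_i tpow (b i) (tnth t i)) * tpow c (a - \sum_i tnth t i).

Definition dirichlet d (b : 'I_d -> R) (c a : R) : \bar R :=
  (\int[lebesgue_tuple d]_t (dirichlet_density b c a t)%:E)%E.

Lemma dirichlet_density_ge0 d (b : 'I_d -> R) c a t :
  (0 <= (dirichlet_density b c a t)%:E)%E.
Proof.
by rewrite lee_fin mulr_ge0 ?tpow_ge0// prodr_ge0// => i _; exact: tpow_ge0.
Qed.

Lemma measurable_dirichlet_density d (b : 'I_d -> R) c a :
  measurable_fun [set: d.-tuple B] (dirichlet_density b c a).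
Proof.
apply: measurable_funM.
  apply: measurable_prod => i _.
  apply: measurableT_comp; first exact: measurable_tpow.
  exact: measurable_tnth.
apply: measurableT_comp; first exact: measurable_tpow.
apply: measurable_funB => //.
apply: measurable_sum => i; exact: measurable_tnth.
Qed.

Lemma dirichlet_density_cons d (b : 'I_d.+1 -> R) c a (x : R) (t : d.-tuple B) :
  dirichlet_density b c a (tuple_cons (x, t)) =
  tpow (b ord0) x * dirichlet_density (b \o lift ord0) c (a - x) t.
Proof.
rewrite /dirichlet_density !big_ord_recl tnth0 /= -mulrA; congr (_ * (_ * _)).
  by apply: eq_bigr => i _; rewrite tnthS.
by rewrite opprD addrA; congr (tpow _ (_ - _)); apply: eq_bigr => i _; rewrite tnthS.
Qed.

Lemma integral_dirichlet_cons d (b : 'I_d.+1 -> R) c a (x : R) :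
  (\int[lebesgue_tuple d]_t (dirichlet_density b c a (tuple_cons (x, t)))%:E =
   (tpow (b ord0) x)%:E * dirichlet (b \o lift ord0) c (a - x))%E.
Proof.
rewrite -ge0_integralZl_EFin//; last 3 first.
- by move=> t _; exact: dirichlet_density_ge0.
- apply/measurable_EFinP; exact: measurable_dirichlet_density.
- exact: tpow_ge0.
by apply: eq_integral => t _; rewrite dirichlet_density_cons EFinM.
Qed.

Lemma dirichlet_head d (b : 'I_d.+1 -> R) c a :
  (dirichlet b c a =
   \int[mu]_x ((tpow (b ord0) x)%:E * dirichlet (b \o lift ord0) c (a - x)))%E.
Proof.
rewrite /dirichlet integral_tuple_head//; last 2 first.
- apply/measurable_EFinP; exact: measurable_dirichlet_density.
- by move=> t; exact: dirichlet_density_ge0.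
by apply: eq_integral => x _; rewrite integral_dirichlet_cons.
Qed.

Lemma measurable_dirichlet_head d (b : 'I_d.+1 -> R) c a :
  measurable_fun [set: R]
    (fun x => (tpow (b ord0) x)%:E * dirichlet (b \o lift ord0) c (a - x))%E.
Proof.
under eq_fun do rewrite -integral_dirichlet_cons.
apply: (measurable_integral_head (g := EFin \o dirichlet_density b c a)).
  apply/measurable_EFinP; exact: measurable_dirichlet_density.
by move=> t; exact: dirichlet_density_ge0.
Qed.

Lemma integral_dirichlet_cons_tail d (b : 'I_d.+1 -> R) c a (t : d.-tuple B) :
  (\int[mu]_x (dirichlet_density b c a (tuple_cons (x, t)))%:E =
   (\prod_i tpow (b (lift ord0 i)) (tnth t i))%:E *
      \int[mu]_x (tpow (b ord0) x * tpow c (a - \sum_i tnth t i - x))%:E)%E.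
Proof.
rewrite -ge0_integralZl_EFin//; last 3 first.
- by move=> x _; rewrite lee_fin mulr_ge0 ?tpow_ge0.
- apply/measurable_EFinP; apply: measurable_funM; first exact: measurable_tpow.
  by apply: (measurableT_comp (measurable_tpow c)); exact: measurable_funB.
- by apply: prodr_ge0 => i _; exact: tpow_ge0.
apply: eq_integral => x _; rewrite dirichlet_density_cons -EFinM.
by rewrite /dirichlet_density mulrCA addrAC.
Qed.

Lemma dirichlet_tail d (b : 'I_d.+1 -> R) c a :
  (dirichlet b c a =
   \int[lebesgue_tuple d]_t ((\prod_i tpow (b (lift ord0 i)) (tnth t i))%:E *
      \int[mu]_x (tpow (b ord0) x * tpow c (a - \sum_i tnth t i - x))%:E))%E.
Proof.
rewrite /dirichlet integral_tuple_tail//; last 2 first.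
- apply/measurable_EFinP; exact: measurable_dirichlet_density.
- by move=> t; exact: dirichlet_density_ge0.
by apply: eq_integral => t _; rewrite integral_dirichlet_cons_tail.
Qed.

Lemma measurable_dirichlet_tail d (b : 'I_d.+1 -> R) c a :
  measurable_fun [set: d.-tuple B]
    (fun t : d.-tuple B => ((\prod_i tpow (b (lift ord0 i)) (tnth t i))%:E *
      \int[mu]_x (tpow (b ord0) x * tpow c (a - \sum_i tnth t i - x))%:E))%E.
Proof.
under eq_fun do rewrite -integral_dirichlet_cons_tail.
apply: (measurable_integral_tail (g := EFin \o dirichlet_density b c a)).
  apply/measurable_EFinP; exact: measurable_dirichlet_density.
by move=> t; exact: dirichlet_density_ge0.
Qed.

Lemma dirichlet_ge0 d (b : 'I_d -> R) c a : (0 <= dirichlet b c a)%E.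
Proof. by apply: integral_ge0 => t _; exact: dirichlet_density_ge0. Qed.

Lemma dirichlet_headZ d (b : 'I_d.+1 -> R) c a k : 0 <= k ->
  (k%:E * dirichlet b c a =
   \int[mu]_x (k%:E *
     ((tpow (b ord0) x)%:E * dirichlet (b \o lift ord0) c (a - x))))%E.
Proof.
move=> k0; rewrite dirichlet_head ge0_integralZl_EFin//.
- by move=> x _; apply: mule_ge0 (dirichlet_ge0 _ _ _); rewrite lee_fin tpow_ge0.
- exact: measurable_dirichlet_head.
Qed.

Lemma dirichlet_tailZ d (b : 'I_d.+1 -> R) c a k : 0 <= k ->
  (k%:E * dirichlet b c a =
   \int[lebesgue_tuple d]_t (k%:E *
     ((\prod_i tpow (b (lift ord0 i)) (tnth t i))%:E *
      \int[mu]_x (tpow (b ord0) x * tpow c (a - \sum_i tnth t i - x))%:E)))%E.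
Proof.
move=> k0; rewrite dirichlet_tail ge0_integralZl_EFin//.
- move=> t _; apply: mule_ge0.
    by rewrite lee_fin; apply: prodr_ge0 => i _; exact: tpow_ge0.
  by apply: integral_ge0 => x _; rewrite lee_fin mulr_ge0 ?tpow_ge0.
- exact: measurable_dirichlet_tail.
Qed.

Definition raise d (b : 'I_d -> R) (i j : 'I_d) : R := b j + (j == i)%:R.

(** Differentiating the product of the powers b_i + 1 and c + 1 along the edge that
    joins coordinate i to the slack, and integrating to 0.  For the head coordinate
    this is the beta identity with the other coordinates fixed; every other
    coordinate is reached by induction on the dimension. *)
Lemma dirichlet_raise d (b : 'I_d -> R) c a i :
  (forall j, -1 < b j) -> -1 < c ->
  ((b i + 1)%:E * dirichlet b (c + 1) a =
   (c + 1)%:E * dirichlet (raise b i) c a)%E.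
Proof.
move=> + c1; have c0 : 0 < c + 1 by rewrite -ltrBlDr sub0r.
elim: d b i a => [b [//]|d IH] b i a b1.
have b0 j : 0 < b j + 1 by rewrite -ltrBlDr sub0r.
case: (unliftP ord0 i) => [k|] ->.
  rewrite (dirichlet_headZ _ _ _ (ltW (b0 _))) (dirichlet_headZ _ _ _ (ltW c0)).
  apply: eq_integral => x _.
  rewrite muleCA (IH (b \o lift ord0) k) => [|j]; last exact: b1.
  have -> : raise b (lift ord0 k) ord0 = b ord0.
    by rewrite /raise (negPf (neq_lift _ _)) addr0.
  rewrite muleCA; congr (_ * (_ * dirichlet _ _ _))%E.
rewrite (dirichlet_tailZ _ _ _ (ltW (b0 _))) (dirichlet_tailZ _ _ _ (ltW c0)).
apply: eq_integral => t _.
rewrite muleCA [RHS]muleCA; congr (_ * _)%E.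
  congr (_%:E); apply: eq_bigr => j _.
  by rewrite /raise eq_sym (negPf (neq_lift _ _)) addr0.
rewrite /raise eqxx/=.
have := @tpow_ibp R (a - \sum_i tnth t i) (b ord0 + 1) (c + 1) (b0 _) c0.
by rewrite !addrK.
Qed.

Lemma dirichlet_density_raise d (b : 'I_d -> R) c a i (t : d.-tuple B) :
  dirichlet_density (raise b i) c a t = tnth t i * dirichlet_density b c a t.
Proof.
rewrite /dirichlet_density mulrA (bigD1 i)//= [in RHS](bigD1 i)//= mulrA.
rewrite /raise eqxx tpowD1; congr (_ * _ * _).
by apply: eq_bigr => j /negPf ->; rewrite addr0.
Qed.

(** The coordinates and the slack add up to a. *)
Lemma dirichlet_sum d (b : 'I_d -> R) c a : 0 <= a ->
  (a%:E * dirichlet b c a =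
   dirichlet b (c + 1) a + \sum_i dirichlet (raise b i) c a)%E.
Proof.
move=> a0; rewrite /dirichlet -ge0_integralZl_EFin//; last 2 first.
- by move=> t _; exact: dirichlet_density_ge0.
- apply/measurable_EFinP; exact: measurable_dirichlet_density.
rewrite -ge0_integral_sum//; last 2 first.
- move=> i; apply/measurable_EFinP; exact: measurable_dirichlet_density.
- by move=> i t _; exact: dirichlet_density_ge0.
rewrite -ge0_integralD//; last 4 first.
- by move=> t _; exact: dirichlet_density_ge0.
- apply/measurable_EFinP; exact: measurable_dirichlet_density.
- by move=> t _; apply: sume_ge0 => i _; exact: dirichlet_density_ge0.
- apply: emeasurable_sum => i; apply/measurable_EFinP.
  exact: measurable_dirichlet_density.
apply: eq_integral => t _; rewrite sumEFin -EFinD -EFinM; congr (_%:E).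
under eq_bigr do rewrite dirichlet_density_raise.
by rewrite -mulr_suml /dirichlet_density tpowD1; ring.
Qed.

(** Each term of [dirichlet_sum] is a multiple of the first one by [dirichlet_raise]. *)
Lemma dirichlet_raised_total d (b : 'I_d -> R) c a : 0 <= a ->
  (forall j, -1 < b j) -> -1 < c ->
  (((c + 1) * a)%:E * dirichlet b c a =
   (c + 1 + \sum_i (b i + 1))%:E * dirichlet b (c + 1) a)%E.
Proof.
move=> a0 b1 c1; have c0 : 0 < c + 1 by rewrite -ltrBlDr sub0r.
have b0 j : 0 < b j + 1 by rewrite -ltrBlDr sub0r.
rewrite EFinM -muleA dirichlet_sum// ge0_muleDr ?dirichlet_ge0//; last first.
  by apply: sume_ge0 => i _; exact: dirichlet_ge0.
rewrite (EFinD (c + 1)) ge0_muleDl; last 2 first.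
- by rewrite lee_fin ltW.
- by rewrite lee_fin; apply: sumr_ge0 => i _; exact: ltW.
congr (_ + _)%E; rewrite ge0_sume_distrr; last first.
  by move=> i _; exact: dirichlet_ge0.
rewrite -sumEFin ge0_sume_distrl; last by move=> i _; rewrite lee_fin ltW.
apply: eq_bigr => i _; apply/esym/dirichlet_raise => //.
Qed.

Lemma lty_pmule (k : R) (x : \bar R) : 0 < k -> (k%:E * x < +oo -> x < +oo)%E.
Proof.
by move=> k0; case: x => [r| |]//; rewrite ?ltry// gt0_muley ?lte_fin.
Qed.

End dirichlet.

Section dirichlet_finite.
Context {R : realType}.
Local Notation B := (measurableTypeR R).
Local Notation mu := (@lebesgue_measure R).

Lemma dirichlet_le0 d (b : 'I_d -> R) c a : a <= 0 -> dirichlet b c a = 0%E.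
Proof.
move=> a0; apply: integral0_eq => t _; congr (_%:E).
rewrite /dirichlet_density; apply/eqP; rewrite mulf_eq0.
have [/forallP H|] := boolP [forall i, 0 < tnth t i].
  apply/orP; right; rewrite /tpow ltNge (le_trans _ a0)//= gerBl.
  by apply: sumr_ge0 => i _; exact: ltW.
rewrite negb_forall => /existsP[i ti]; apply/orP; left.
by rewrite (bigD1 i)//= /tpow (negPf ti) mul0r.
Qed.

Lemma dirichlet_le1 d (b : 'I_d -> R) c a : (forall i, 0 <= b i) -> 0 <= c ->
  a <= 1 -> (dirichlet b c a <= 1)%E.
Proof.
move=> + c0; elim: d b a => [|d IH] b a b0 a1.
  apply: (@le_trans _ _ (\int[lebesgue_tuple 0]_t (cst 1%E t))%E).
    apply: ge0_le_integral => //.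
    - by move=> t _; exact: dirichlet_density_ge0.
    - apply/measurable_EFinP; exact: measurable_dirichlet_density.
    - move=> t _; rewrite lee_fin /dirichlet_density big_ord0 mul1r.
      by rewrite big_ord0 subr0 tpow_le1.
  by rewrite integral_cst// mul1e /= diracT.
rewrite dirichlet_head.
apply: (@le_trans _ _ (\int[mu]_x (\1_`]0%R, 1%R[ x)%:E)%E); last first.
  have M : mu `]0, 1[%classic = 1%E.
    by rewrite lebesgue_measure_itv/= lte_fin ltr01 sube0.
  by rewrite integral_indic// setIT le_eqVlt; apply/orP; left; apply/eqP; exact: M.
apply: ge0_le_integral => //.
- by move=> x _; apply: mule_ge0; rewrite ?lee_fin ?tpow_ge0 ?dirichlet_ge0.
- exact: measurable_dirichlet_head.
- by apply/measurable_EFinP; exact: measurable_indic.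
move=> x _; rewrite indicE mem_setE in_itv/=.
have [x0|x0] /= := ltP 0 x; last by rewrite /tpow ltNge x0/= mul0e.
have [x1|x1] /= := ltP x 1; last first.
  by rewrite dirichlet_le0 ?mule0// subr_le0 (le_trans a1).
rewrite -[leRHS]mule1; apply: lee_pmul.
- by rewrite lee_fin tpow_ge0.
- exact: dirichlet_ge0.
- by rewrite lee_fin; apply: tpow_le1 => //; exact: ltW.
by apply: IH => [i|]; [exact: b0|rewrite lerBlDr (le_trans a1)// lerDl ltW].
Qed.

(** Finiteness descends from the exponent c + 1 to c, since the two integrals are
    proportional; in this way singular exponents reduce to nonnegative ones. *)
Lemma lty_dirichlet_raise d (b : 'I_d -> R) c a : 0 < a ->
  (forall j, -1 < b j) -> -1 < c ->
  (dirichlet b (c + 1) a < +oo -> dirichlet b c a < +oo)%E.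
Proof.
move=> a0 b1 c1 D; have c0 : 0 < c + 1 by rewrite -ltrBlDr sub0r.
apply: (@lty_pmule _ ((c + 1) * a)); first exact: mulr_gt0.
rewrite dirichlet_raised_total ?(ltW a0)//; apply: lte_mul_pinfty => //.
rewrite lee_fin addr_ge0 ?(ltW c0)// sumr_ge0// => i _.
by rewrite ltW// -ltrBlDr sub0r.
Qed.

(** Raise the negative exponents by one, one coordinate at a time, until the density
    is bounded by 1. *)
Lemma dirichlet_lty d (b : 'I_d -> R) c : (forall j, -1 < b j) -> -1 < c ->
  (dirichlet b c 1 < +oo)%E.
Proof.
move=> b1 c1; apply: lty_dirichlet_raise => //.
have : 0 <= c + 1 by rewrite ltW// -ltrBlDr sub0r.
move: (c + 1) => e e0 {c c1}.
suff H m : forall b : 'I_d -> R, (forall j, -1 < b j) ->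
    (forall i : 'I_d, (m <= i)%N -> 0 <= b i) -> (dirichlet b e 1 < +oo)%E.
  by apply: (H d) => // i; rewrite leqNgt ltn_ord.
(* m counts the coordinates whose exponent may still be negative. *)
elim: m => [|m IH] {b1}b b1 bm.
  by apply: le_lt_trans (ltry 1); apply: dirichlet_le1 => // i; exact: bm.
have [md|dm] := ltnP m d; last first.
  apply: IH => // i mi; apply: bm; rewrite ltn_neqAle mi andbT.
  by apply: contraTneq (ltn_ord i) => <-; rewrite -leqNgt.
pose i := Ordinal md.
have e1 : -1 < e by exact: lt_le_trans e0.
apply: lty_dirichlet_raise => //.
have i0 : 0 < b i + 1 by rewrite -ltrBlDr sub0r.
apply: (lty_pmule i0).
rewrite dirichlet_raise//; apply: lte_mul_pinfty => //.
  by rewrite lee_fin addr_ge0.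
apply: IH => j.
  by rewrite /raise (lt_le_trans (b1 j))// lerDl.
rewrite leq_eqVlt => /predU1P[mj|mj]; rewrite /raise.
  have -> : j = i by exact: val_inj.
  by rewrite eqxx ltW.
by rewrite addr_ge0// bm.
Qed.

Lemma measurable_hyperplane d (w : 'I_d -> R) c :
  measurable [set t : d.-tuple B | \sum_j w j * tnth t j = c].
Proof.
have mw : measurable_fun [set: d.-tuple B]
    (fun t : d.-tuple B => \sum_j w j * tnth t j).
  apply: measurable_sum => j; apply: measurable_funM => //.
  exact: measurable_tnth.
by have := mw measurableT [set c] (measurable_set1 c); rewrite setTI.
Qed.

(** If the head coordinate has a nonzero coefficient, the sections along it are
    single points; otherwise the claim is inherited from the sections at a fixed
    head. *)
Lemma lebesgue_tuple_hyperplane d (w : 'I_d -> R) c i : w i != 0 ->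
  lebesgue_tuple d [set t | \sum_j w j * tnth t j = c] = 0%E.
Proof.
have E n (v : 'I_n -> R) e : lebesgue_tuple n [set t | \sum_j v j * tnth t j = e] =
    (\int[lebesgue_tuple n]_t
      (\1_[set t : n.-tuple B | \sum_j v j * tnth t j = e] t)%:E)%E.
  rewrite integral_indic//; last exact: measurable_hyperplane.
  congr (lebesgue_tuple n _).
  by apply/seteqP; split=> [t //=|t []].
elim: d w c i => [w c [//]|d IH] w c i wi.
have mI n (v : 'I_n -> R) e : measurable_fun [set: n.-tuple B]
   (EFin \o (\1_[set t : n.-tuple B | \sum_j v j * tnth t j = e] : _ -> R)).
  by apply/measurable_EFinP; apply: measurable_indic; exact: measurable_hyperplane.
have F (x : R) (t : d.-tuple B) :
   \1_[set t : d.+1.-tuple B | \sum_j w j * tnth t j = c] (tuple_cons (x, t)) =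
   \1_[set t : d.-tuple B | \sum_j (w \o lift ord0) j * tnth t j = c - w ord0 * x] t :> R.
  have S : \sum_j w j * tnth (tuple_cons (x, t)) j =
      w ord0 * x + \sum_j (w \o lift ord0) j * tnth t j.
    rewrite big_ord_recl; congr (_ + _); apply: eq_bigr => j _.
    by congr (_ * _); exact: tnthS.
  rewrite !indicE; congr (_%:R); congr (nat_of_bool _).
  apply/idP/idP; rewrite !inE/= S; first by move=> <-; rewrite addrAC subrr add0r.
  by move=> ->; rewrite addrC subrK.
have g0 (t : d.+1.-tuple B) : (0 <=
  (EFin \o (\1_[set t : d.+1.-tuple B | (\sum_j w j * tnth t j)%R = c] : _ -> R)) t)%E.
  by rewrite lee_fin.
rewrite E; have [k ik|i0] := unliftP ord0 i.
  rewrite (integral_tuple_head (mI _ _ _) g0).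
  apply: integral0_eq => x _ /=.
  under eq_integral do rewrite F.
  by rewrite -E (IH _ _ k)//= -ik.
rewrite (integral_tuple_tail (mI _ _ _) g0).
apply: integral0_eq => t _ /=.
rewrite i0 in wi.
set s := \sum_j (w \o lift ord0) j * tnth t j.
transitivity (\int[mu]_x (\1_[set ((c - s) / w ord0)%R] x)%:E)%E.
  apply: eq_integral.
  move=> x _; rewrite F /= !indicE; congr (_%:R%:E); congr (nat_of_bool _).
  apply/idP/idP; rewrite !inE/= => Es.
    have -> : s = c - w ord0 * x by [].
    by rewrite opprB addrCA subrr addr0 mulrC mulKf.
  suff : s = c - w ord0 * x by [].
  by rewrite Es mulrCA divff// mulr1 opprB addrCA subrr addr0.
rewrite integral_indic// setIT; exact: lebesgue_measure_set1.
Qed.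
End dirichlet_finite.

(** * Barycentric coordinates and monomial masses *)

Section barycentric.
Context {R : realType} {d : nat}.
Local Notation S := (simplex : set (euclid R d)).
Local Notation B := (measurableTypeR R).
Implicit Types (x : 'rV[R]_d) (i : 'I_d.+1) (alpha : 'I_d.+1 -> R).

(** Indexed like the vertices: the coordinate of the origin comes first.  In these
    coordinates the weight and the Bernstein polynomials are monomials, and the
    edges are treated alike. *)
Definition bary i x : R :=
  if unlift ord0 i is Some j then x 0 j else 1 - coord_sum x.

Lemma bary0 x : bary ord0 x = 1 - coord_sum x.
Proof. by rewrite /bary unlift_none. Qed.

Lemma bary_lift x j : bary (lift ord0 j) x = x 0 j.
Proof. by rewrite /bary liftK. Qed.

Lemma sum_bary x : \sum_i bary i x = 1.
Proof.
rewrite big_ord_recl bary0; under eq_bigr do rewrite bary_lift.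
by rewrite subrK.
Qed.

(** The weight exponents reindexed like the vertices; the last one, that of 1 - |x|,
    belongs to the origin. *)
Definition vweight alpha i : R :=
  if unlift ord0 i is Some j then alpha (widen_ord (leqnSn d) j)
  else alpha ord_max.

Lemma vweight0 alpha : vweight alpha ord0 = alpha ord_max.
Proof. by rewrite /vweight unlift_none. Qed.

Lemma vweight_lift alpha j :
  vweight alpha (lift ord0 j) = alpha (widen_ord (leqnSn d) j).
Proof. by rewrite /vweight liftK. Qed.

Lemma vweight_gtN1 alpha : (forall i, -1 < alpha i) ->
  forall i, -1 < vweight alpha i.
Proof. by move=> a1 i; rewrite /vweight; case: unliftP. Qed.

Lemma sum_vweight alpha : \sum_i vweight alpha i = \sum_i alpha i.
Proof.
rewrite big_ord_recl big_ord_recr /= vweight0 addrC; congr (_ + _).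
by apply: eq_bigr => j _; rewrite vweight_lift.
Qed.

Lemma jacobi_weight_bary alpha x :
  jacobi_weight alpha x = \prod_i bary i x `^ vweight alpha i.
Proof.
rewrite /jacobi_weight big_ord_recl bary0 vweight0 mulrC; congr (_ * _).
by apply: eq_bigr => j _; rewrite bary_lift vweight_lift.
Qed.

Lemma jacobi_weight_ge0 alpha x : 0 <= jacobi_weight alpha x.
Proof.
by rewrite jacobi_weight_bary prodr_ge0// => i _; exact: powR_ge0.
Qed.

Lemma simplexP x : S x <-> forall i, 0 <= bary i x.
Proof.
split=> [[x0 x1] i|H].
  rewrite /bary; case: unliftP => [j _|_]; first exact: x0.
  by rewrite subr_ge0.
split=> [j|]; first by rewrite -bary_lift.
by rewrite -subr_ge0 -bary0.
Qed.

Lemma measurable_coord j : measurable_fun [set: euclid R d] (fun x : euclid R d => x 0 j : R).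
Proof.
have -> : (fun x : euclid R d => x 0 j : R) =
    (fun t : d.-tuple B => tnth t j) \o tuple_of_rV.
  by apply/funext => x /=; rewrite tnth_mktuple.
apply: measurableT_comp; first exact: measurable_tnth.
exact: measurable_tuple_of_rV.
Qed.

Lemma measurable_bary i : measurable_fun [set: euclid R d] (bary i : euclid R d -> R).
Proof.
case: (unliftP ord0 i) => [j|] ->.
  have -> : bary (lift ord0 j) = (fun x => x 0 j).
    by apply/funext => x; rewrite bary_lift.
  exact: measurable_coord.
have -> : bary ord0 = (fun x => 1 - coord_sum x).
  by apply/funext => x; rewrite bary0.
apply: measurable_funB; first exact: measurable_cst.
by apply: measurable_sum => j; exact: measurable_coord.
Qed.

Lemma measurable_simplex : measurable S.
Proof.
have -> : S = \big[setI/setT]_(i < d.+1) ((bary i : euclid R d -> R) @^-1` `[0, +oo[).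
  apply/seteqP; split => x.
    move/simplexP => x0; rewrite -bigcap_seq => i _ /=.
    by rewrite in_itv/= andbT x0.
  rewrite -bigcap_seq => H; apply/simplexP => i.
  by have /= := H i (mem_index_enum i); rewrite in_itv/= andbT.
apply: bigsetI_measurable => i _.
by rewrite -[X in measurable X]setTI; exact: measurable_bary.
Qed.

Lemma measurable_jacobi_weight alpha :
  measurable_fun [set: euclid R d] (jacobi_weight alpha : euclid R d -> R).
Proof.
have -> : jacobi_weight alpha = (fun x => \prod_i bary i x `^ vweight alpha i).
  by apply/funext => x; rewrite jacobi_weight_bary.
apply: measurable_prod => i _.
apply: (measurableT_comp (@measurable_powR R _)).
exact: measurable_bary.
Qed.

Definition bmono (k : 'I_d.+1 -> nat) x : R := \prod_i bary i x ^+ k i.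

Lemma measurable_bmono k : measurable_fun [set: euclid R d] (bmono k : euclid R d -> R).
Proof.
apply: measurable_prod => i _; apply: measurable_funX; exact: measurable_bary.
Qed.

Lemma bmono_ge0 k x : S x -> 0 <= bmono k x.
Proof. by move/simplexP => x0; apply: prodr_ge0 => i _; exact: exprn_ge0. Qed.

Lemma bary_le1 i x : S x -> bary i x <= 1.
Proof.
move=> /simplexP x0; rewrite -(sum_bary x) (bigD1 i)//= lerDl.
by apply: sumr_ge0.
Qed.

Lemma bmono_le1 k x : S x -> bmono k x <= 1.
Proof.
move=> Sx; have /simplexP x0 := Sx.
by apply: prodr_ile1 => i _; rewrite exprn_ge0//= exprn_ile1// bary_le1.
Qed.

(** They contain the boundary of the simplex, and off them the truncated powers
    agree with the true ones within the simplex. *)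
Definition boundary_hyperplanes : set (euclid R d) := [set x | exists i, bary i x = 0].

Lemma lebesgue_rV_hyperplane i : (0 < d)%N ->
  lebesgue_rV ([set x | bary i x = 0] : set (euclid R d)) = 0%E.
Proof.
move=> d0.
have [w [c [j [wj E]]]] : exists w c j, w j != 0 /\ forall x : 'rV[R]_d,
    (bary i x = 0 <-> \sum_j w j * x 0 j = c).
  case: (unliftP ord0 i) => [j|] ->.
    exists (fun k => (k == j)%:R), 0, j; split; first by rewrite eqxx oner_eq0.
    move=> x; rewrite bary_lift (bigD1 j)//= eqxx mul1r big1 ?addr0// => k /negPf ->.
    by rewrite mul0r.
  exists (fun=> 1), 1, (Ordinal d0); split; first exact: oner_neq0.
  move=> x; rewrite bary0 /coord_sum; under [in X in _ <-> X]eq_bigr do rewrite mul1r.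
  by split=> [/subr0_eq/esym//|->]; rewrite subrr.
have -> : [set x | bary i x = 0] =
    tuple_of_rV @^-1` [set t : d.-tuple B | \sum_j w j * tnth t j = c].
  apply/seteqP; split => x /=.
    by move/E => <-; apply: eq_bigr => k _; rewrite tnth_mktuple.
  by move=> H2; apply/E; rewrite -H2; apply: eq_bigr => k _; rewrite tnth_mktuple.
rewrite lebesgue_rV_preimage; last exact: measurable_hyperplane.
exact: lebesgue_tuple_hyperplane wj.
Qed.

Lemma boundary_hyperplanes_null : (0 < d)%N ->
  measurable boundary_hyperplanes /\ lebesgue_rV boundary_hyperplanes = 0%E.
Proof.
move=> d0.
have -> : boundary_hyperplanes =
    \big[setU/set0]_(i < d.+1) ([set x | bary i x = 0] : set (euclid R d)).
  apply/seteqP; split => x.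
    by move=> [i xi]; rewrite -bigcup_seq; exists i => //=; exact: mem_index_enum.
  by rewrite -bigcup_seq => -[i _ xi]; exists i.
have m i : measurable ([set x | bary i x = 0] : set (euclid R d)).
  by have := measurable_bary i measurableT (measurable_set1 0); rewrite setTI.
elim/big_ind : _ => [|A A' [mA A0] [mA' A'0]|i _].
- by split=> //; exact: measure0.
- split; first exact: measurableU.
  by rewrite measureU0.
- by split; [exact: m|exact: lebesgue_rV_hyperplane].
Qed.

Definition mass alpha k : R :=
  \int[lebesgue_rV]_(x in S) (bmono k x * jacobi_weight alpha x).

Definition dexp alpha k i : R := (k i)%:R + vweight alpha i.

Lemma dexp_gtN1 alpha k i : (forall i, -1 < alpha i) -> -1 < dexp alpha k i.
Proof.
move=> a1; rewrite -[ltLHS]add0r; apply: ler_ltD => //.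
exact: vweight_gtN1.
Qed.

Lemma powR_expr_tpow (b : R) n a : 0 <= b -> b != 0 -> b ^+ n * b `^ a = tpow (n%:R + a) b.
Proof.
move=> b0 bn0; rewrite /tpow lt_neqAle eq_sym bn0 b0 -powR_mulrn//.
by rewrite powRD// bn0 implybT.
Qed.

(** On a hyperplane equality can fail: a power of 0 with exponent 0 is 1, a truncated
    one is 0. *)
Lemma bmono_weight_density alpha k (x : euclid R d) :
  ~ boundary_hyperplanes x ->
  ((fun x : euclid R d => bmono k x * jacobi_weight alpha x) \_ S) x =
  dirichlet_density (dexp alpha k \o lift ord0) (dexp alpha k ord0) 1
    (tuple_of_rV x).
Proof.
move=> nx; rewrite patchE /dirichlet_density.
have -> : 1 - \sum_i tnth (tuple_of_rV x) i = bary ord0 x.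
  by rewrite bary0; congr (_ - _); apply: eq_bigr => i _; rewrite tnth_mktuple.
under eq_bigr do rewrite tnth_mktuple -bary_lift.
have -> : (\prod_i tpow ((dexp alpha k \o lift ord0) i) (bary (lift ord0 i) x)) *
    tpow (dexp alpha k ord0) (bary ord0 x) =
    \prod_i tpow (dexp alpha k i) (bary i x).
  by rewrite big_ord_recl mulrC.
case: ifPn => [|xS].
  rewrite inE => /simplexP x0.
  rewrite /bmono jacobi_weight_bary -big_split/=; apply: eq_bigr => i _.
  by rewrite powR_expr_tpow//; apply: contra_notN nx => /eqP ?; exists i.
have [i xi] : exists i, bary i x < 0.
  apply: contrapT => H; move/negP: xS; apply; rewrite inE; apply/simplexP => i.
  by rewrite leNgt; apply/negP => ?; apply: H; exists i.
by rewrite (bigD1 i)//= /tpow ltNge (ltW xi)/= mul0r.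
Qed.

Lemma mass_dirichlet alpha k : (0 < d)%N ->
  (\int[lebesgue_rV]_(x in S) (bmono k x * jacobi_weight alpha x)%:E =
   dirichlet (dexp alpha k \o lift ord0) (dexp alpha k ord0) 1)%E.
Proof.
move=> d0; have [mN N0] := boundary_hyperplanes_null d0.
have mf : measurable_fun [set: euclid R d]
  ((fun x : euclid R d => bmono k x * jacobi_weight alpha x) \_ S).
  apply/(measurable_restrictT _ measurable_simplex).
  apply: measurable_funTS; apply: measurable_funM.
    exact: measurable_bmono.
  exact: measurable_jacobi_weight.
have mg : measurable_fun [set: d.-tuple B] (EFin \o dirichlet_density
    (dexp alpha k \o lift ord0) (dexp alpha k ord0) 1).
  by apply/measurable_EFinP; exact: measurable_dirichlet_density.
rewrite /dirichlet -integral_lebesgue_rV//; last first.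
  by move=> t; exact: dirichlet_density_ge0.
have RE : (fun x : euclid R d => (bmono k x * jacobi_weight alpha x)%:E) \_ S =
    EFin \o ((fun x : euclid R d => bmono k x * jacobi_weight alpha x) \_ S).
  by rewrite -restrict_EFin.
rewrite integral_mkcond RE; apply: ge0_ae_eq_integral.
- exact: measurableT.
- exact/measurable_EFinP.
- exact: measurableT_comp mg (measurable_tuple_of_rV).
- move=> x _; rewrite /= lee_fin; apply: restrict_ge0 => {}x Sx.
  by rewrite mulr_ge0 ?bmono_ge0 ?jacobi_weight_ge0.
- by move=> x _; exact: dirichlet_density_ge0.
- exists boundary_hyperplanes; split => // x /=; apply: contra_notP => nx _.
  by rewrite /= bmono_weight_density.
Qed.

#[local] Opaque dirichlet.

Lemma integrable_bmono_weight alpha k : (0 < d)%N -> (forall i, -1 < alpha i) ->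
  lebesgue_rV.-integrable S (fun x : euclid R d => (bmono k x * jacobi_weight alpha x)%:E).
Proof.
move=> d0 a1; apply/integrableP; split.
  apply/measurable_EFinP; apply: measurable_funTS; apply: measurable_funM.
    exact: measurable_bmono.
  exact: measurable_jacobi_weight.
rewrite (eq_integral (fun x : euclid R d => (bmono k x * jacobi_weight alpha x)%:E)); last first.
  move=> x; rewrite inE => Sx.
  by rewrite gee0_abs// lee_fin mulr_ge0 ?bmono_ge0 ?jacobi_weight_ge0.
rewrite mass_dirichlet//; apply: dirichlet_lty; last exact: dexp_gtN1.
by move=> j; exact: dexp_gtN1.
Qed.

Definition incr k i (j : 'I_d.+1) : nat := (k j + (j == i))%N.

Definition rho alpha : R := d%:R + \sum_i alpha i.

Lemma sum_dexp alpha k :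
  \sum_i (dexp alpha k i + 1) = (\sum_i k i)%N%:R + rho alpha + 1.
Proof.
rewrite big_split/= big_split/= sum_vweight sumr_const card_ord natr_sum /rho.
by rewrite -natr1; ring.
Qed.

(** The ratio of consecutive Dirichlet integrals.  For the origin it is
    [dirichlet_raised_total]; the other vertices follow through
    [dirichlet_raise]. *)
Lemma mass_incr alpha k i : (0 < d)%N -> (forall i, -1 < alpha i) ->
  ((\sum_i k i)%N%:R + rho alpha + 1) * mass alpha (incr k i) =
  (dexp alpha k i + 1) * mass alpha k.
Proof.
move=> d0 a1.
have b1 j : -1 < dexp alpha k j by exact: dexp_gtN1.
have b0 j : 0 < dexp alpha k j + 1 by rewrite -ltrBlDr sub0r.
pose b := dexp alpha k \o lift ord0; pose c := dexp alpha k ord0.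
have fin k' : (dirichlet (dexp alpha k' \o lift ord0) (dexp alpha k' ord0) 1) \is a fin_num.
  rewrite ge0_fin_numE ?dirichlet_ge0//; apply: dirichlet_lty; last exact: dexp_gtN1.
  by move=> j; exact: dexp_gtN1.
have mE k' : (mass alpha k')%:E = dirichlet (dexp alpha k' \o lift ord0) (dexp alpha k' ord0) 1.
  by rewrite /mass /Rintegral mass_dirichlet// fineK.
have e0 : dexp alpha (incr k ord0) ord0 = c + 1.
  by rewrite /dexp /incr eqxx natrD addrAC.
have eb : dexp alpha (incr k ord0) \o lift ord0 = b.
  by apply/funext => j; rewrite /dexp /incr /= addn0.
have H0 : ((\sum_i k i)%N%:R + rho alpha + 1) * mass alpha (incr k ord0) =
    (c + 1) * mass alpha k.
  apply: EFin_inj; rewrite !EFinM !mE e0 eb -sum_dexp big_ord_recl.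
  have := @dirichlet_raised_total R d b c 1 ler01 (fun j => b1 _) (b1 _).
  by rewrite mulr1 => ->.
case: (unliftP ord0 i) => [j|] -> //.
have H1 : (b j + 1) * mass alpha (incr k ord0) = (c + 1) * mass alpha (incr k (lift ord0 j)).
  apply: EFin_inj; rewrite !EFinM !mE e0 eb dirichlet_raise; last 2 first.
  - by move=> ?; exact: b1.
  - exact: b1.
  have -> : dexp alpha (incr k (lift ord0 j)) \o lift ord0 = raise b j.
    apply/funext => l; rewrite /raise /b /dexp /incr /= (inj_eq lift_inj) natrD.
    by rewrite addrAC.
  by rewrite /dexp /incr (negPf (neq_lift _ _)) addn0.
have c0 : c + 1 != 0 by rewrite gt_eqF// b0.
apply: (mulfI c0); rewrite mulrCA -H1 mulrCA H0 -/b.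
by rewrite mulrCA.
Qed.

End barycentric.

(** * Derivatives along the edges *)

Section line_derivative.
Context {R : realType} {V : normedModType R}.
Implicit Types (f : V -> R) (x v : V).

Lemma is_derive_line f x v (df : R) :
  is_derive (0 : R) 1 (fun h : R => f (h *: v + x)) df -> is_derive x v f df.
Proof.
move=> [d1 d2]; split; first exact/derivable1P.
rewrite -d2 /derive; congr (lim (_ @ 0^')).
apply/funext => h /=; congr (_ *: (_ - _)).
  by congr (f (_ *: _ + _)); rewrite /GRing.scale/= mulr1 addr0.
by rewrite scale0r add0r.
Qed.

Lemma is_derive_sum_seq (I : Type) (s : seq I) (F : I -> V -> R) (dF : I -> R) x v :
  (forall i, is_derive x v (F i) (dF i)) ->
  is_derive x v (fun y => \sum_(i <- s) F i y) (\sum_(i <- s) dF i).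
Proof.
move=> dFi; elim: s => [|i s IH].
  have -> : (fun y => \sum_(i <- [::]) F i y) = cst 0.
    by apply/funext => y; rewrite big_nil.
  by rewrite big_nil; exact: is_derive_cst.
have -> : (fun y => \sum_(i <- i :: s) F i y) = F i + (fun y => \sum_(i <- s) F i y).
  by apply/funext => y; rewrite big_cons.
by rewrite big_cons; exact: is_deriveD.
Qed.
End line_derivative.

Section barycentric_derivative.
Context {R : realType} {d : nat}.
Implicit Types (x v : 'rV[R]_d) (i j m : 'I_d.+1).

(** The linear part of [bary m]. *)
Definition dbary m v : R :=
  if unlift ord0 m is Some l then v 0 l else - coord_sum v.

Lemma bary_line m x v (h : R) : bary m (h *: v + x) = bary m x + h * dbary m v.
Proof.
rewrite /bary /dbary; case: (unlift ord0 m) => [l|].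
  by rewrite !mxE addrC.
have -> : coord_sum (h *: v + x) = h * coord_sum v + coord_sum x.
  rewrite /coord_sum mulr_sumr -big_split/=.
  by apply: eq_bigr => l _; rewrite !mxE.
ring.
Qed.

Definition open_simplex : set 'rV[R]_d := [set x | forall m, 0 < bary m x].

Lemma continuous_bary m : continuous (bary m : 'rV[R]_d -> R).
Proof.
case: (unliftP ord0 m) => [l|] ->.
  have -> : bary (lift ord0 l) = (fun x => x 0 l).
    by apply/funext => x; rewrite bary_lift.
  exact: coord_continuous.
have -> : bary ord0 = (fun x => 1 - coord_sum x).
  by apply/funext => x; rewrite bary0.
move=> x; apply: continuousB; first exact: cst_continuous.
rewrite /coord_sum; apply: continuous_big => [|l _]; last exact: coord_continuous.
exact: add_continuous.
Qed.

Lemma near_open_simplex x : open_simplex x -> \forall y \near x, open_simplex y.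
Proof.
move=> xU.
have : \forall y \near x, forall m, 0 < bary m y.
  apply: (@filter_forall 'rV[R]_d 'I_d.+1 (fun m => [set y | is_true (0 < bary m y)]) (nbhs x)) => m.
  exact: (cvgr_gt _ (@continuous_bary m x) _ (xU m)).
by [].
Qed.

(** Real exponents put the weight, the monomials and their products in one family,
    with a single derivative formula. *)
Definition rpow (e : 'I_d.+1 -> R) x : R := \prod_m bary m x `^ e m.

Lemma rpow_gt0 e x : open_simplex x -> 0 < rpow e x.
Proof. by move=> xU; apply: prodr_gt0 => m _; rewrite powR_gt0. Qed.

Lemma rpowD e f x : open_simplex x ->
  rpow (fun m => e m + f m) x = rpow e x * rpow f x.
Proof.
move=> xU; rewrite -big_split/=; apply: eq_bigr => m _.
by rewrite powRD// (gt_eqF (xU m)) implybT.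
Qed.

Lemma is_derive_bary_line m x v :
  is_derive (0 : R) 1 (fun h : R => bary m (h *: v + x)) (dbary m v).
Proof.
have -> : (fun h : R => bary m (h *: v + x)) =
    cst (bary m x) + dbary m v \*: (id : R -> R).
  by apply/funext => h /=; rewrite bary_line mulrC.
apply: is_derive_eq.
by rewrite add0r scaler1.
Qed.

Lemma is_derive_bary m x v : is_derive x v (bary m) (dbary m v).
Proof. by apply: is_derive_line; exact: is_derive_bary_line. Qed.

Lemma is_derive_bary_powR m (e : R) x v : 0 < bary m x ->
  is_derive x v (fun y => bary m y `^ e)
    (bary m x `^ e * (e * dbary m v / bary m x)).
Proof.
move=> b0; apply: is_derive_line.
have D2 : is_derive (bary m (0 *: v + x)) 1 (@powR R ^~ e)
    (e * bary m x `^ (e - 1)).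
  by rewrite scale0r add0r; exact: is_derive1_powR.
have D := @is_derive1_comp R (@powR R ^~ e) (fun h => bary m (h *: v + x))
  0 _ _ D2 (is_derive_bary_line m x v).
apply: (is_derive_eq D).
rewrite powRB; last by rewrite (gt_eqF b0) implybT.
by rewrite powRr1 ?ltW//; field; rewrite gt_eqF.
Qed.

(** Derivatives are written as value times logarithmic derivative, and logarithmic
    derivatives add up over a product. *)
Lemma is_derive_bary_prod (f : 'I_d.+1 -> 'rV[R]_d -> R) (l : 'I_d.+1 -> R) x v :
  (forall m, is_derive x v (f m) (f m x * l m)) ->
  is_derive x v (fun y => \prod_m f m y) (\prod_m f m x * \sum_m l m).
Proof.
move=> df; elim: (index_enum _) => [|m s IH].
  have -> : (fun y => \prod_(m <- [::]) f m y) = cst 1.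
    by apply/funext => y; rewrite big_nil.
  by rewrite !big_nil mulr0; exact: is_derive_cst.
have -> : (fun y => \prod_(m <- m :: s) f m y) =
    f m * (fun y => \prod_(m <- s) f m y).
  by apply/funext => y; rewrite big_cons.
apply: is_derive_eq (is_deriveM (df m) IH) _.
by rewrite !big_cons /GRing.scale/=; ring.
Qed.

Lemma is_derive_rpow e x v : open_simplex x ->
  is_derive x v (rpow e) (rpow e x * \sum_m e m * dbary m v / bary m x).
Proof.
by move=> xU; apply: is_derive_bary_prod => m; exact: is_derive_bary_powR.
Qed.

Lemma bmono_rpow k x : open_simplex x -> bmono k x = rpow (fun m => (k m)%:R) x.
Proof.
by move=> xU; apply: eq_bigr => m _; rewrite powR_mulrn// ltW.
Qed.

Lemma jacobi_weight_rpow alpha x : jacobi_weight alpha x = rpow (vweight alpha) x.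
Proof. exact: jacobi_weight_bary. Qed.

Lemma coord_sum_vertex i : coord_sum (@simplex_vertex R d i) = (i != ord0)%:R.
Proof.
rewrite /coord_sum; under eq_bigr do rewrite mxE.
case: (unliftP ord0 i) => [l|] ->; last first.
  by rewrite eqxx big1// => l _; rewrite (negPf (neq_lift _ _)).
rewrite eq_sym neq_lift (bigD1 l)//= eqxx big1 ?addr0// => m ml.
by rewrite (inj_eq lift_inj) eq_sym (negPf ml).
Qed.

(** The inverse length of the edge, so that the edge direction has norm 1. *)
Definition edge_scale i j : R :=
  (euclid_dist (@simplex_vertex R d i) (simplex_vertex j))^-1.

Lemma dbary_edge i j m : dbary m (edge_direction i j) =
  edge_scale i j * ((m == i)%:R - (m == j)%:R).
Proof.
rewrite /dbary; case: (unliftP ord0 m) => [l|] ->.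
  by rewrite !mxE ![lift _ _ == _]eq_sym.
rewrite /edge_direction -/(edge_scale i j).
have -> : coord_sum (edge_scale i j *: (simplex_vertex i - simplex_vertex j)) =
    edge_scale i j * (coord_sum (@simplex_vertex R d i) - coord_sum (@simplex_vertex R d j)).
  rewrite /coord_sum -sumrB mulr_sumr.
  by apply: eq_bigr => l _; rewrite !mxE.
rewrite !coord_sum_vertex ![ord0 == _]eq_sym.
by case: (i == ord0); case: (j == ord0) => /=; ring.
Qed.

Lemma euclid_normZ (a : R) v : euclid_norm (a *: v) = `|a| * euclid_norm v.
Proof.
rewrite /euclid_norm -sqrtr_sqr -sqrtrM ?sqr_ge0// mulr_sumr.
by congr (Num.sqrt _); apply: eq_bigr => l _; rewrite mxE exprMn.
Qed.

Lemma euclid_norm_eq0 v : euclid_norm v = 0 -> v = 0.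
Proof.
move=> /eqP; rewrite sqrtr_eq0 => H.
apply/rowP => l; rewrite mxE; apply/eqP; rewrite -sqrf_eq0 eq_le sqr_ge0 andbT.
apply: le_trans H; rewrite (bigD1 l)//= lerDl.
by apply: sumr_ge0 => m _; exact: sqr_ge0.
Qed.

Lemma simplex_vertex_inj : injective (@simplex_vertex R d).
Proof.
move=> i j ij.
have H l : (i == lift ord0 l) = (j == lift ord0 l).
  have /rowP/(_ l) := ij; rewrite !mxE => /eqP.
  by rewrite eqr_nat; case: (i == _); case: (j == _).
case: (unliftP ord0 i) => [l il|i0].
  by have := H l; rewrite il eqxx => /esym/eqP ->.
case: (unliftP ord0 j) => [l jl|->//].
by have := H l; rewrite jl eqxx i0.
Qed.

Lemma edge_scale_gt0 i j : i != j -> 0 < edge_scale i j.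
Proof.
move=> ij; rewrite invr_gt0 lt_neqAle sqrtr_ge0 andbT eq_sym.
apply: contra_neqN ij => /eqP/euclid_norm_eq0/eqP; rewrite subr_eq0 => /eqP.
exact: simplex_vertex_inj.
Qed.

Lemma euclid_norm_edge i j : i != j -> euclid_norm (@edge_direction R d i j) = 1.
Proof.
move=> ij; rewrite euclid_normZ gtr0_norm ?edge_scale_gt0//.
rewrite mulVf// -invr_eq0 gt_eqF//; exact: edge_scale_gt0.
Qed.

(** Moving from x by l along the edge changes the coordinates i and j by c l and
    - c l; the simplex is left when the coordinate j reaches 0. *)
Lemma reach_edge (xi : 'rV[R]_d) (c : R) i j x : i != j -> 0 < c ->
  euclid_norm xi = 1 ->
  (forall m, dbary m xi = c * ((m == i)%:R - (m == j)%:R)) ->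
  simplex x -> reach xi x = bary j x / c.
Proof.
move=> ij c0 n1 dxi Sx; have /simplexP x0 := Sx.
rewrite /reach.
have -> : [set euclid_dist x (x + l *: xi) | l in
        [set l : R | 0 <= l /\ simplex (x + l *: xi)]] = `[0, bary j x / c]%classic.
  have Sl (l : R) : 0 <= l -> simplex (x + l *: xi) <-> l <= bary j x / c.
    move=> l0; rewrite (simplexP (x + l *: xi)) addrC; split.
      move=> /(_ j); rewrite bary_line dxi eqxx eq_sym (negPf ij) sub0r.
      by rewrite ler_pdivlMr// mulrN1 mulrN subr_ge0.
    move=> lb m; rewrite bary_line dxi.
    have [->|mi] := eqVneq m i.
      by rewrite (negPf ij) subr0 mulr1 addr_ge0// mulr_ge0// ltW.
    have [->|mj] := eqVneq m j; last by rewrite subrr !mulr0 addr0.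
    by rewrite sub0r mulrN1 mulrN subr_ge0 -ler_pdivlMr.
  have dl (l : R) : 0 <= l -> euclid_dist x (x + l *: xi) = l.
    move=> l0; rewrite /euclid_dist opprD addrA subrr sub0r -scaleNr euclid_normZ.
    by rewrite n1 mulr1 normrN ger0_norm.
  apply/seteqP; split => l /=.
    by move=> [l' [l0 /(Sl _ l0) lb] <-]; rewrite dl// in_itv/= l0.
  rewrite in_itv/= => /andP[l0 lb]; exists l; last exact: dl.
  by split=> //; apply/Sl.
by rewrite real_interval.sup_itvcc// divr_ge0// ltW.
Qed.

Lemma dtilde_edge i j x : i != j -> simplex x ->
  dtilde (edge_direction i j) x = bary i x * bary j x / edge_scale i j ^+ 2.
Proof.
move=> ij Sx; have c0 := edge_scale_gt0 ij.
rewrite /dtilde (reach_edge ij c0 (euclid_norm_edge ij) (dbary_edge i j) Sx).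
have ji : j != i by rewrite eq_sym.
rewrite (@reach_edge _ (edge_scale i j) j i)//.
- by field; rewrite gt_eqF.
- by rewrite -scaleN1r euclid_normZ normrN1 mul1r euclid_norm_edge.
move=> m; have -> : dbary m (- edge_direction i j) = - dbary m (edge_direction i j).
  rewrite /dbary; case: (unlift _ _) => [l|]; first by rewrite mxE.
  by congr (- _); rewrite /coord_sum -sumrN; apply: eq_bigr => l _; rewrite mxE.
by rewrite dbary_edge -mulrN opprB.
Qed.

Lemma sum_edge_log (e : 'I_d.+1 -> R) i j x : i != j ->
  \sum_m e m * dbary m (edge_direction i j) / bary m x =
  edge_scale i j * (e i / bary i x - e j / bary j x).
Proof.
move=> ij; have ji : j != i by rewrite eq_sym.
rewrite (bigD1 i)//= (bigD1 j)//=.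
rewrite big1 ?addr0 => [|m /andP[mi mj]].
  by rewrite !dbary_edge !eqxx (negPf ij) (negPf ji) /=; ring.
by rewrite dbary_edge (negPf mi) (negPf mj) subrr !(mulr0, mul0r).
Qed.

(** With the one for (j, i) it makes up the ratio of w^-1 D (dtilde w D x^k) to x^k,
    for D the derivative along the edge from i to j. *)
Definition edge_factor alpha (k : 'I_d.+1 -> nat) i j x : R :=
  (k i)%:R * ((vweight alpha i + (k i)%:R) * bary j x / bary i x
              - (vweight alpha j + (k j)%:R + 1)).

Lemma simplex_open x : open_simplex x -> simplex x.
Proof. by move=> xU; apply/simplexP => m; exact: ltW. Qed.

Lemma is_derive_bmono_edge (k : 'I_d.+1 -> nat) i j x : i != j -> open_simplex x ->
  is_derive x (edge_direction i j) (bmono k)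
    (bmono k x * (edge_scale i j * ((k i)%:R / bary i x - (k j)%:R / bary j x))).
Proof.
move=> ij xU.
rewrite bmono_rpow// -(sum_edge_log (fun m => (k m)%:R))//.
apply: near_eq_is_derive (is_derive_rpow _ _ xU).
by apply: filterS (near_open_simplex xU) => y yU; rewrite bmono_rpow.
Qed.

(** The flux dtilde w D x^k is a difference of two power products, because the
    factors 1 / x_i and 1 / x_j of D x^k are cancelled by dtilde. *)
Lemma is_derive_edge_flux alpha k i j x : i != j -> open_simplex x ->
  is_derive x (edge_direction i j)
    (fun y => dtilde (edge_direction i j) y * jacobi_weight alpha y *
      (bmono k y * (edge_scale i j * ((k i)%:R / bary i y - (k j)%:R / bary j y))))
    (jacobi_weight alpha x * bmono k x *
      (edge_factor alpha k i j x + edge_factor alpha k j i x)).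
Proof.
move=> ij xU; have ji : j != i by rewrite eq_sym.
have c0 := edge_scale_gt0 ij; set c := edge_scale i j in c0 *.
pose e m := vweight alpha m + (k m)%:R.
pose ei m := e m + (m == i)%:R.
pose ej m := e m + (m == j)%:R.
have R1 m y : open_simplex y -> rpow (fun l => e l + (l == m)%:R) y =
    jacobi_weight alpha y * bmono k y * bary m y.
  move=> yU; rewrite rpowD// rpowD// -jacobi_weight_rpow -bmono_rpow//.
  congr (_ * _); rewrite /rpow (bigD1 m)//= eqxx powRr1 ?ltW// big1 ?mulr1// => l.
  by move=> /negPf ->; rewrite powRr0.
have F : {near x, (fun y => c^-1 * ((k i)%:R * rpow ej y - (k j)%:R * rpow ei y)) =1
   (fun y => dtilde (edge_direction i j) y * jacobi_weight alpha y *
      (bmono k y * (c * ((k i)%:R / bary i y - (k j)%:R / bary j y))))}.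
  apply: filterS (near_open_simplex xU) => y yU.
  rewrite !R1// dtilde_edge//; last exact: simplex_open.
  have := yU i; have := yU j => bj bi.
  by rewrite -/c; field; rewrite !gt_eqF.
apply: near_eq_is_derive F _.
have -> : (fun y => c^-1 * ((k i)%:R * rpow ej y - (k j)%:R * rpow ei y)) =
    c^-1 \*: ((k i)%:R \*: rpow ej - (k j)%:R \*: rpow ei) by [].
have Di := is_derive_rpow ei (edge_direction i j) xU.
have Dj := is_derive_rpow ej (edge_direction i j) xU.
apply: is_derive_eq (is_deriveZ _ (is_deriveB (is_deriveZ _ Dj) (is_deriveZ _ Di))) _.
rewrite !sum_edge_log// -/c /GRing.scale/= !R1// /ei /ej !eqxx (negPf ij).
rewrite (negPf ji) /edge_factor /e.
have := xU i; have := xU j => bj bi.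
by rewrite !(mulr0n, mulr1n); field; rewrite !gt_eqF.
Qed.

Lemma sum_edges (A : 'I_d.+1 -> 'I_d.+1 -> R) :
  \sum_(i < d.+1) \sum_(j < d.+1 | (i < j)%N) (A i j + A j i) =
  \sum_i \sum_(j | j != i) A i j.
Proof.
under eq_bigr do rewrite big_split/=.
rewrite big_split/= [X in _ + X](exchange_big_dep predT)//= -big_split/=.
apply: eq_bigr => i _; rewrite [RHS](bigID (fun j : 'I_d.+1 => (i < j)%N))/=.
congr (_ + _); apply: eq_bigl => j; rewrite -val_eqE /= neq_ltn.
  by case: ltngtP.
by case: ltngtP.
Qed.

(** Summing over j first: the coordinates other than x_i add up to 1 - x_i, and the
    numbers alpha_j + k_j + 1 over all j to |k| + rho + 1. *)
Lemma sum_edge_factor alpha k x : open_simplex x ->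
  \sum_i \sum_(j | j != i) edge_factor alpha k i j x =
  (\sum_i (k i)%:R * (vweight alpha i + (k i)%:R) / bary i x) -
    (\sum_i (k i)%:R) * (\sum_i (k i)%:R + rho alpha).
Proof.
move=> xU.
have K : \sum_j (vweight alpha j + (k j)%:R + 1) = \sum_i (k i)%:R + rho alpha + 1.
  rewrite !big_split/= sum_vweight sumr_const card_ord /rho -natr1; ring.
rewrite mulr_suml -sumrB; apply: eq_bigr => i _.
rewrite /edge_factor -mulr_sumr sumrB.
have -> : \sum_(j | j != i) (vweight alpha i + (k i)%:R) * bary j x / bary i x =
    (vweight alpha i + (k i)%:R) * (1 - bary i x) / bary i x.
  rewrite -mulr_suml -mulr_sumr; congr (_ * _ / _).
  by rewrite -(sum_bary x) [in RHS](bigD1 i)//= addrAC subrr add0r.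
have -> : \sum_(j | j != i) (vweight alpha j + (k j)%:R + 1) =
    \sum_i (k i)%:R + rho alpha - (vweight alpha i + (k i)%:R).
  by move: K; rewrite (bigD1 i)//= => K; lra.
by field; rewrite gt_eqF.
Qed.

(** * Polynomials and the action of P(D) *)

(** A polynomial is given by a list of coefficients and multi-indices, so that
    linear combinations become concatenations. *)
Definition bpoly (s : seq (R * ('I_d.+1 -> nat))) x : R :=
  \sum_(p <- s) p.1 * bmono p.2 x.

(** In the formula x^k k_i (k_i + alpha_i) / x_i is a multiple of a monomial of degree
    |k| - 1, or 0 when k_i = 0; keeping the quotient avoids a truncated exponent. *)
Lemma P_D_bpoly alpha s x : open_simplex x ->
  P_D alpha (bpoly s) x =
  \sum_(p <- s) p.1 * (bmono p.2 x *
    (\sum_i (p.2 i)%:R * (vweight alpha i + (p.2 i)%:R) / bary i x -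
    (\sum_i (p.2 i)%:R) * (\sum_i (p.2 i)%:R + rho alpha))).
Proof.
move=> xU; have w0 : 0 < jacobi_weight alpha x.
  by rewrite jacobi_weight_rpow rpow_gt0.
under [RHS]eq_bigr => p _ do rewrite -sum_edge_factor// -sum_edges !mulr_sumr.
rewrite exchange_big/=; apply: eq_bigr => i _.
under [RHS]eq_bigr => p _ do rewrite !mulr_sumr.
rewrite exchange_big/=; apply: eq_bigr => j ij.
have {}ij : i != j by rewrite neq_ltn ij.
pose D (k : 'I_d.+1 -> nat) y := bmono k y *
  (edge_scale i j * ((k i)%:R / bary i y - (k j)%:R / bary j y)).
have dZ (h : 'rV[R]_d -> R) y v (a dh : R) : is_derive y v h dh ->
    is_derive y v (fun z => a * h z) (a * dh).
  by move=> H; exact: (is_deriveZ a H).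
have Dg y : open_simplex y ->
    'D_(edge_direction i j) (bpoly s) y = \sum_(p <- s) p.1 * D p.2 y.
  move=> yU; apply: derive_val.
  by apply: is_derive_sum_seq => p; apply: dZ; exact: is_derive_bmono_edge.
set G := (fun y => _).
have -> : 'D_(edge_direction i j) G x =
  \sum_(p <- s) p.1 * (jacobi_weight alpha x * bmono p.2 x *
      (edge_factor alpha p.2 i j x + edge_factor alpha p.2 j i x)).
  apply: derive_val.
  apply: (@near_eq_is_derive _ _ _ (fun y => \sum_(p <- s) p.1 *
     (dtilde (edge_direction i j) y * jacobi_weight alpha y * D p.2 y))).
    apply: filterS (near_open_simplex xU) => y yU.
    by rewrite /G Dg// mulr_sumr; apply: eq_bigr => p _; ring.
  by apply: is_derive_sum_seq => p; apply: dZ; exact: is_derive_edge_flux.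
rewrite mulr_sumr; apply: eq_bigr => p _.
by field; rewrite gt_eqF.
Qed.

End barycentric_derivative.

(** * Sums over multi-indices of a given degree *)

Section multi_index.
Context {d : nat}.
Implicit Types (n : nat) (i : 'I_d.+1).

(** Entries are bounded by n in anticipation of the degree being n. *)
Definition mindex n := {ffun 'I_d.+1 -> 'I_n.+1}.

Definition mval n (k : mindex n) i : nat := k i.

Definition mdegree (k : 'I_d.+1 -> nat) : nat := (\sum_i k i)%N.

Lemma mdegree_incr k i : mdegree (incr k i) = (mdegree k).+1.
Proof.
rewrite /mdegree /incr big_split/= (bigD1 i)//= [X in (_ + X)%N](bigD1 i)//= eqxx.
by rewrite [X in (1 + X)%N]big1 ?addn0 ?addn1// => j /negPf ->.
Qed.

Definition mincr n i (m : mindex n) : mindex n.+1 := [ffun j => inord (incr (mval m) i j)].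
Definition mdecr n i (k : mindex n.+1) : mindex n := [ffun j => inord (k j - (j == i))].

Lemma mval_mincr n i (m : mindex n) : mval (mincr i m) = incr (mval m) i.
Proof.
apply/funext => j; rewrite /mval ffunE inordK// /incr ltnS.
by rewrite -[X in (_ <= X)%N]addn1 leq_add// ?leq_b1// -ltnS ltn_ord.
Qed.

Lemma mincrK n i : cancel (@mincr n i) (mdecr i).
Proof.
move=> m; apply/ffunP => j; rewrite ffunE; apply: val_inj.
rewrite /= -[nat_of_ord (mincr i m j)]/(mval (mincr i m) j) mval_mincr /incr addnK.
by rewrite inordK// ltn_ord.
Qed.

Lemma mdecrK n i (k : mindex n.+1) : mdegree (mval k) = n.+1 -> (0 < k i)%N ->
  mincr i (mdecr i k) = k.
Proof.
move=> kn ki; apply/ffunP => j; apply: val_inj.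
rewrite /= -[nat_of_ord (mincr i _ j)]/(mval (mincr i _) j) mval_mincr /incr.
rewrite /mval ffunE inordK.
  by have [->|_] := eqVneq j i; rewrite ?subn0 ?addn0// subnK.
have [->|ji] := eqVneq j i.
  by rewrite ltnS leq_subLR add1n -ltnS ltn_ord.
have kji : (k j + k i <= mdegree (mval k))%N.
  by rewrite /mdegree (bigD1 j)//= (bigD1 i)//= 1?eq_sym// addnA leq_addr.
rewrite subn0; apply: leq_trans (_ : k j + k i <= n.+1)%N.
  by rewrite -[X in (X < _)%N]addn0 ltn_add2l.
by rewrite -[X in (_ <= X)%N]kn.
Qed.

End multi_index.

Section multi_sum.
Context {R : realType} {d : nat}.
Implicit Types (n : nat) (i : 'I_d.+1) (G : ('I_d.+1 -> nat) -> R).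

Definition mindex_sum n G : R :=
  \sum_(k : mindex (d := d) n | mdegree (mval k) == n) G (mval k).

(** Substituting k = m + e_i; the terms with k_i = 0 drop out thanks to the factor
    k_i. *)
Lemma mindex_sum_shift n (G : 'I_d.+1 -> ('I_d.+1 -> nat) -> R) :
  mindex_sum n.+1 (fun k => \sum_i (k i)%:R * G i k) =
  mindex_sum n (fun m => \sum_i (m i).+1%:R * G i (incr m i)).
Proof.
rewrite /mindex_sum exchange_big/= [RHS]exchange_big/=; apply: eq_bigr => i _.
rewrite (bigID (fun k : mindex (d := d) n.+1 => (0 < k i)%N))/= [X in _ + X]big1 ?addr0; last first.
  by move=> k /andP[_]; rewrite -eqn0Ngt /mval => /eqP ->; rewrite mul0r.
rewrite (reindex_onto (mincr i) (mdecr i)); last first.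
  by move=> k /andP[/eqP kn ki]; exact: mdecrK.
apply: eq_big => [m|m _]; last first.
  by rewrite mval_mincr /incr eqxx addn1.
rewrite mincrK eqxx andbT mval_mincr mdegree_incr eqSS.
have -> : (0 < mincr i m i)%N.
  by rewrite -[nat_of_ord (mincr i m i)]/(mval (mincr i m) i) mval_mincr /incr eqxx addn1.
by rewrite andbT.
Qed.

(** Completes a multi-index by the exponent of 1 - |x|. *)
Definition mext n (k : 'I_d -> nat) i : nat :=
  if unlift ord0 i is Some j then k j else (n - \sum_j k j)%N.

Lemma mindex_sum_ext n G :
  \sum_(k : {ffun 'I_d -> 'I_n.+1} | (\sum_i k i <= n)%N) G (mext n (val \o k)) =
  mindex_sum n G.
Proof.
pose h (k : mindex (d := d) n) : {ffun 'I_d -> 'I_n.+1} := [ffun j => k (lift ord0 j)].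
pose h' (k : {ffun 'I_d -> 'I_n.+1}) : mindex (d := d) n :=
  [ffun i => inord (mext n (val \o k) i)].
have h'E k : mval (h' k) = mext n (val \o k).
  apply/funext => i; rewrite /mval ffunE inordK// /mext.
  by case: (unlift _ _) => [j|] /=; rewrite ?ltn_ord// ltnS leq_subr.
rewrite (reindex_onto h h'); last first.
  move=> k _; apply/ffunP => j; apply: val_inj; rewrite ffunE.
  by rewrite -[LHS]/(mval (h' k) (lift ord0 j)) h'E /mext liftK.
have hS (k : mindex (d := d) n) : mdegree (mval k) = (k ord0 + \sum_j h k j)%N.
  by rewrite /mdegree big_ord_recl; congr addn; apply: eq_bigr => j _; rewrite ffunE.
have hE k : mdegree (mval k) = n -> mext n (val \o h k) = mval k.
  move=> kn; apply/funext => i; rewrite /mext.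
  case: (unliftP ord0 i) => [j|] -> /=; first by rewrite ffunE.
  by rewrite -[X in (X - _)%N]kn hS addnK.
apply: eq_big => [k|k /andP[kn /eqP hk]]; last first.
  by rewrite -{2}hk h'E.
apply/andP/eqP => [[kn /eqP hk]|kn].
  rewrite -hk h'E /mdegree big_ord_recl {1}/mext unlift_none.
  under [X in (_ + X)%N]eq_bigr do rewrite /mext liftK.
  by rewrite subnK.
split; first by rewrite -[X in (_ <= X)%N]kn hS leq_addl.
apply/eqP/ffunP => i; apply: val_inj.
by rewrite -[LHS]/(mval (h' (h k)) i) h'E hE.
Qed.

End multi_sum.

(** * The Bernstein-Durrmeyer operators *)

Section durrmeyer.
Context {R : realType} {d : nat}.
Local Notation S := (simplex : set (euclid R d)).
Variable alpha : 'I_d.+1 -> R.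
Hypotheses (d0 : (0 < d)%N) (a1 : forall i, -1 < alpha i).
Variable f : 'rV[R]_d -> R.
Hypothesis mf : measurable_fun S (f : euclid R d -> R).
Hypothesis If : lebesgue_rV.-integrable S
  (fun y : euclid R d => (f y * jacobi_weight alpha y)%:E).
Implicit Types (k m : 'I_d.+1 -> nat) (x : 'rV[R]_d) (i : 'I_d.+1).

Definition moment k : R :=
  \int[lebesgue_rV]_(y in S) (f y * bmono k y * jacobi_weight alpha y).

Lemma integrable_moment k : lebesgue_rV.-integrable S
  (fun y : euclid R d => (f y * bmono k y * jacobi_weight alpha y)%:E).
Proof.
apply: le_integrable If; first exact: measurable_simplex.
  apply/measurable_EFinP; apply: measurable_funM; first apply: measurable_funM => //.
    by apply: measurable_funTS; exact: measurable_bmono.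
  by apply: measurable_funTS; exact: measurable_jacobi_weight.
move=> y Sy; rewrite !abse_EFin lee_fin !normrM.
rewrite ler_wpM2r// -[leRHS]mulr1 ler_wpM2l// ger0_norm; first exact: bmono_le1.
exact: bmono_ge0.
Qed.

Lemma bmono_incr k i x : bmono (incr k i) x = bary i x * bmono k x.
Proof.
rewrite /bmono (bigD1 i)//= [in RHS](bigD1 i)//= /incr eqxx addn1 exprS -mulrA.
by congr (_ * (_ * _)); apply: eq_bigr => j /negPf ->; rewrite addn0.
Qed.

(** The barycentric coordinates sum to 1. *)
Lemma sum_moment_incr k : \sum_i moment (incr k i) = moment k.
Proof.
have mE k' : (moment k')%:E =
    (\int[lebesgue_rV]_(y in S) (f y * bmono k' y * jacobi_weight alpha y)%:E)%E.
  rewrite /moment /Rintegral fineK//; apply: integrable_fin_num.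
    exact: measurable_simplex.
  exact: integrable_moment.
apply: EFin_inj; rewrite -sumEFin mE; under eq_bigr do rewrite mE.
rewrite -(integral_sum (measurable_simplex (R := R) (d := d))); last first.
  by move=> i; exact: integrable_moment.
apply: eq_integral => y _; rewrite sumEFin; congr (_%:E).
under eq_bigr do rewrite bmono_incr.
by rewrite -mulr_suml; congr (_ * _); rewrite -mulr_sumr -mulr_suml sum_bary mul1r.
Qed.

Definition multinom k : R := (mdegree k)`!%:R / (\prod_i (k i)`!)%N%:R.

Lemma multinom_gt0 k : 0 < multinom k.
Proof.
rewrite divr_gt0// ltr0n ?fact_gt0//.
by apply: prodn_gt0 => i; exact: fact_gt0.
Qed.

Lemma multinom_incr k i :
  (k i).+1%:R * multinom (incr k i) = (mdegree k).+1%:R * multinom k.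
Proof.
have P : (\prod_j (incr k i j)`! = (k i).+1 * \prod_j (k j)`!)%N.
  rewrite (bigD1 i)//= [in RHS](bigD1 i)//= /incr eqxx addn1 factS -mulnA.
  by congr (_ * (_ * _))%N; apply: eq_bigr => j /negPf ->; rewrite addn0.
rewrite /multinom mdegree_incr factS P !natrM.
have p0 : (\prod_j (k j)`!)%N%:R != 0 :> R.
  by rewrite pnatr_eq0 -lt0n; apply: prodn_gt0 => j; exact: fact_gt0.
have k0 : (k i).+1%:R != 0 :> R by rewrite pnatr_eq0.
move: k0 p0; move: ((k i).+1%:R : R) ((\prod_j (k j)`!)%N%:R : R) => u v u0 v0.
by field; rewrite ?u0 ?v0.
Qed.

Lemma bernstein_bmono n (k : 'I_d -> nat) x : (\sum_i k i <= n)%N ->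
  bernstein n k x = multinom (mext n k) * bmono (mext n k) x.
Proof.
move=> kn; rewrite /bernstein /multinom /bmono !big_ord_recl.
have -> : mdegree (mext n k) = n.
  rewrite /mdegree big_ord_recl {1}/mext unlift_none.
  by under [X in (_ + X)%N]eq_bigr do rewrite /mext liftK; rewrite subnK.
have E0 : mext n k ord0 = (n - \sum_j k j)%N by rewrite /mext unlift_none.
have El j : mext n k (lift ord0 j) = k j by rewrite /mext liftK.
have -> : (\prod_(j < d) (mext n k (lift ord0 j))`! = \prod_j (k j)`!)%N.
  by apply: eq_bigr => j _; rewrite El.
have -> : \prod_(j < d) bary (lift ord0 j) x ^+ mext n k (lift ord0 j) =
    \prod_j x 0 j ^+ k j.
  by apply: eq_bigr => j _; rewrite El bary_lift.
rewrite E0 bary0 [in RHS]mulnC -!mulrA; congr (_ * (_ * _)).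
by rewrite mulrC.
Qed.

(** The normalising factor of the Bernstein polynomial cancels in the quotient. *)
Definition bd_coef k : R := multinom k * (moment k / mass alpha k).

Lemma bernstein_durrmeyerE n x :
  bernstein_durrmeyer alpha n f x = mindex_sum n (fun k => bd_coef k * bmono k x).
Proof.
rewrite -mindex_sum_ext; apply: eq_bigr => k kn.
set K := mext n (val \o k).
have mS := measurable_simplex (R := R) (d := d).
have E y : bernstein n (val \o k) y = multinom K * bmono K y.
  by rewrite bernstein_bmono.
have -> : \int[lebesgue_rV]_(y in S) (bernstein n (val \o k) y * jacobi_weight alpha y) =
    multinom K * mass alpha K.
  rewrite /mass -RintegralZl//; last exact: integrable_bmono_weight.
  by apply: eq_Rintegral => y _; rewrite E mulrA.
have -> : \int[lebesgue_rV]_(y in S) (f y * bernstein n (val \o k) y * jacobi_weight alpha y) =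
    multinom K * moment K.
  rewrite /moment -RintegralZl//; last exact: integrable_moment.
  by apply: eq_Rintegral => y _; rewrite E; ring.
rewrite E /bd_coef invfM; have := multinom_gt0 K; move: (multinom K) => c c0.
have : c * c^-1 = 1 by rewrite divff// gt_eqF.
move: (c^-1) => c' cc.
transitivity ((c * c') * c * bmono K x * (mass alpha K)^-1 * moment K); first ring.
by rewrite cc; ring.
Qed.

(** [mass_incr] after inversion, which commutes with products even at 0. *)
Lemma bd_coef_incr m i :
  multinom m * ((dexp alpha m i + 1) * (moment (incr m i) / mass alpha (incr m i))) =
  ((mdegree m)%:R + rho alpha + 1) * (multinom m * moment (incr m i) / mass alpha m).
Proof.
have H := mass_incr m i d0 a1.
have b0 : 0 < dexp alpha m i + 1 by rewrite -ltrBlDr sub0r; exact: dexp_gtN1.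
have s0 : 0 < (mdegree m)%:R + rho alpha + 1.
  by rewrite -sum_dexp (bigD1 ord0)//= ltr_wpDr// ?sumr_ge0// => [j _|];
    rewrite ?ltW// -ltrBlDr sub0r; exact: dexp_gtN1.
have : (mass alpha (incr m i))^-1 = ((mdegree m)%:R + rho alpha + 1) *
    (dexp alpha m i + 1)^-1 * (mass alpha m)^-1.
  rewrite -mulrA -invfM -H invfM mulrA divff ?mul1r//; exact: lt0r_neq0.
move=> ->; move: (mass alpha m)^-1 => c; field.
by rewrite gt_eqF.
Qed.

Definition bd_seq (n : nat) : seq (R * ('I_d.+1 -> nat)) :=
  [seq (bd_coef (mval k), mval k) |
     k : mindex n <- enum [pred k : mindex (d := d) n | mdegree (mval k) == n]].

Lemma sum_bd_seq n (F : R * ('I_d.+1 -> nat) -> R) :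
  \sum_(p <- bd_seq n) F p = mindex_sum n (fun k => F (bd_coef k, k)).
Proof. by rewrite /bd_seq big_map big_enum. Qed.

Lemma bernstein_durrmeyer_bpoly n :
  bernstein_durrmeyer alpha n f = bpoly (bd_seq n).
Proof.
by apply/funext => x; rewrite bernstein_durrmeyerE /bpoly sum_bd_seq.
Qed.

(** P(D) lowers the degree of the monomials in one of its two terms; after the index
    shift that term is a multiple of M_n f, and the other one is a multiple of
    M_(n+1) f. *)
Lemma P_D_bernstein_durrmeyer n x : open_simplex x ->
  P_D alpha (bernstein_durrmeyer alpha n.+1 f) x =
  n.+1%:R * (n.+1%:R + rho alpha) *
    (bernstein_durrmeyer alpha n f x - bernstein_durrmeyer alpha n.+1 f x).
Proof.
move=> xU; rewrite [in LHS]bernstein_durrmeyer_bpoly P_D_bpoly// sum_bd_seq/=.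
pose G i k := bd_coef k * (vweight alpha i + (k i)%:R) * (bmono k x / bary i x).
transitivity (mindex_sum n.+1 (fun k => \sum_i (k i)%:R * G i k) -
    n.+1%:R * (n.+1%:R + rho alpha) * bernstein_durrmeyer alpha n.+1 f x).
  rewrite bernstein_durrmeyerE /mindex_sum mulr_sumr -sumrB.
  apply: eq_bigr => k0 /eqP; move: (mval k0) => k kn.
  have -> : \sum_i (k i)%:R = n.+1%:R :> R by rewrite -natr_sum -kn.
  rewrite !mulrBr; congr (_ - _); last by ring.
  rewrite !mulr_sumr; apply: eq_bigr => i _; rewrite /G; ring.
rewrite mindex_sum_shift mulrBr; congr (_ - _).
rewrite bernstein_durrmeyerE /mindex_sum mulr_sumr.
apply: eq_bigr => m0 /eqP; move: (mval m0) => m mn.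
rewrite -[RHS]/(n.+1%:R * (n.+1%:R + rho alpha) *
  (multinom m * (moment m / mass alpha m) * bmono m x)) -sum_moment_incr.
rewrite mulr_suml mulr_sumr mulr_suml mulr_sumr; apply: eq_bigr => i _.
have bi : bary i x != 0 by rewrite gt_eqF.
rewrite /G bmono_incr.
have -> : bary i x * bmono m x / bary i x = bmono m x by field.
have -> : vweight alpha i + (incr m i i)%:R = dexp alpha m i + 1.
  by rewrite /incr eqxx addn1 -natr1 /dexp; ring.
transitivity (((m i).+1%:R * multinom (incr m i)) *
  ((dexp alpha m i + 1) * (moment (incr m i) / mass alpha (incr m i))) * bmono m x).
  by rewrite /bd_coef; ring.
rewrite multinom_incr mn -[X in X * _]mulrA bd_coef_incr mn -natr1; ring.
Qed.

End durrmeyer.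

(** * Polynomials are twice continuously differentiable *)

Section polynomial_functions.
Context {R : realType} {d : nat}.
Implicit Types (f g : 'rV[R]_d -> R) (x v : 'rV[R]_d).

(** An inductive class rather than [bpoly]: the product rule gives closure under
    directional derivatives without computing any coefficient. *)
Inductive polyfun : ('rV[R]_d -> R) -> Prop :=
| polyfun_cst c : polyfun (cst c)
| polyfun_bary m : polyfun (bary m)
| polyfun_add f g : polyfun f -> polyfun g -> polyfun (fun x => f x + g x)
| polyfun_mul f g : polyfun f -> polyfun g -> polyfun (fun x => f x * g x).

Lemma polyfun_bmono k : polyfun (bmono k).
Proof.
rewrite /bmono; elim: (index_enum _) => [|m s IH].
  under eq_fun do rewrite big_nil; exact: polyfun_cst.
under eq_fun do rewrite big_cons; apply: polyfun_mul IH.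
elim: (k m) => [|n IH]; first by under eq_fun do rewrite expr0; exact: polyfun_cst.
by under eq_fun do rewrite exprS; exact: polyfun_mul (polyfun_bary m) IH.
Qed.

Lemma polyfun_bpoly s : polyfun (bpoly s).
Proof.
rewrite /bpoly; elim: s => [|p s IH].
  under eq_fun do rewrite big_nil; exact: polyfun_cst.
under eq_fun do rewrite big_cons; apply: polyfun_add IH.
exact: polyfun_mul (polyfun_cst p.1) (polyfun_bmono p.2).
Qed.

Lemma continuous_polyfun f : polyfun f -> continuous f.
Proof.
elim=> [c|m|{}f g _ cf _ cg|{}f g _ cf _ cg].
- exact: cst_continuous.
- exact: continuous_bary.
- by move=> x; apply: continuousD; [exact: cf|exact: cg].
- by move=> x; apply: continuousM; [exact: cf|exact: cg].
Qed.

Lemma is_derive_polyfun f v : polyfun f ->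
  exists2 h, polyfun h & forall x, is_derive x v f (h x).
Proof.
elim=> [c|m|{}f g _ [f' pf df] _ [g' pg dg]|{}f g pf [f' pf' df] pg [g' pg' dg]].
- by exists (cst 0) => [|x]; [exact: polyfun_cst|exact: is_derive_cst].
- by exists (cst (dbary m v)) => [|x]; [exact: polyfun_cst|exact: is_derive_bary].
- exists (fun x => f' x + g' x) => [|x]; first exact: polyfun_add.
  exact: is_deriveD (df x) (dg x).
- exists (fun x => f x * g' x + g x * f' x) => [|x].
    by apply: polyfun_add; exact: polyfun_mul.
  exact: is_deriveM (df x) (dg x).
Qed.

Lemma C2_polyfun f : polyfun f -> C2_simplex f.
Proof.
move=> pf; split.
- exact/continuous_subspaceT/continuous_polyfun.
- move=> i; have [h ph dh] := is_derive_polyfun (delta_mx 0 i) pf.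
  by exists h => [|x _ //]; exact/continuous_subspaceT/continuous_polyfun.
- move=> i j; have [h ph dh] := is_derive_polyfun (delta_mx 0 i) pf.
  have [h' ph' dh'] := is_derive_polyfun (delta_mx 0 j) ph.
  exists h'; first exact/continuous_subspaceT/continuous_polyfun.
  move=> x _; have -> : 'D_(delta_mx 0 i) f = h by apply/funext => y; exact: derive_val.
  exact: dh'.
Qed.

Lemma measurable_polyfun f : polyfun f -> measurable_fun [set: euclid R d] (f : euclid R d -> R).
Proof.
elim=> [c|m|{}f g _ mf _ mg|{}f g _ mf _ mg].
- exact: measurable_cst.
- exact: measurable_bary.
- exact: measurable_funD.
- exact: measurable_funM.
Qed.

End polynomial_functions.

(** * The weighted norm *)

Section weighted_norm.
Context {R : realType} {d : nat}.
Local Notation S := (simplex : set (euclid R d)).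
Local Notation mu := (@lebesgue_rV R d).
Variable alpha : 'I_d.+1 -> R.
Implicit Types f g : 'rV[R]_d -> R.

(** Over a null space the essential supremum of a nonnegative function would be
    -oo. *)
Lemma lebesgue_tupleT_gt0 n : (0 < @lebesgue_tuple R n setT)%E.
Proof.
elim: n => [|n IH]; first by rewrite /= diracT.
rewrite /= /cons_measure /pushforward preimage_setT -setXTT product_measure1E//.
apply: mule_gt0 => //.
have : (0 < lebesgue_measure (`]-oo, +oo[%classic : set R))%E.
  by rewrite lebesgue_measure_itv/= addye ?lt0y.
by rewrite set_itvNyy.
Qed.

Lemma lebesgue_rVT_gt0 : (0 < mu setT)%E.
Proof.
rewrite -(preimage_setT tuple_of_rV) lebesgue_rV_preimage//.
exact: lebesgue_tupleT_gt0.
Qed.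

(** Absorbing the weight into the function turns the weighted norm on the simplex
    into an unweighted one on the whole space; for p infinite there is no weight to
    absorb. *)
Definition weighted (p : \bar R) f : euclid R d -> R :=
  if p is q%:E%E then (fun x : euclid R d => f x * jacobi_weight alpha x `^ q^-1) \_ S
  else (f : euclid R d -> R) \_ S.

Lemma measurable_powR_weight q f : measurable_fun S (f : euclid R d -> R) ->
  measurable_fun S (fun x : euclid R d => (`|f x| `^ q * jacobi_weight alpha x)%:E).
Proof.
move=> mf; apply/measurable_EFinP; apply: measurable_funM.
  apply: (measurableT_comp (@measurable_powR R _)).
  exact: measurableT_comp.
apply: measurable_funTS; exact: measurable_jacobi_weight.
Qed.

Lemma powR_weight_ge0 q f (x : 'rV[R]_d) :
  (0 <= (`|f x| `^ q * jacobi_weight alpha x)%:E)%E.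
Proof. by rewrite lee_fin mulr_ge0 ?powR_ge0 ?jacobi_weight_ge0. Qed.

Lemma wnorm_Lnorm p f : (1 <= p)%E -> wnorm alpha p f = Lnorm mu p (EFin \o weighted p f).
Proof.
rewrite unlock; case: p => [q||]// q1.
  have q0 : 0 < q by rewrite (lt_le_trans ltr01).
  rewrite /wnorm; congr (_ `^ _)%E; rewrite integral_mkcond; apply: eq_integral => x _.
  rewrite /weighted /= !patchE; case: ifPn => _ /=.
    rewrite normrM (ger0_norm (powR_ge0 _ _)) powRM ?powR_ge0//.
    by rewrite -powRrM mulVf ?gt_eqF// powRr1// jacobi_weight_ge0.
  by rewrite normr0 powR0// gt_eqF.
rewrite lebesgue_rVT_gt0 /wnorm; congr (ess_sup _ _); apply/funext => x.
by rewrite /= /weighted !patchE; case: ifP => // _; rewrite normr0.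
Qed.

Lemma measurable_weighted p f : measurable_fun S (f : euclid R d -> R) ->
  measurable_fun [set: euclid R d] (weighted p f).
Proof.
move=> mf; rewrite /weighted.
have mS := @measurable_simplex R d.
case: p => [q||]; apply/(measurable_restrictT _ mS); [|exact: mf|exact: mf].
apply: measurable_funM; first exact: mf.
apply: measurable_funTS; apply: (measurableT_comp (@measurable_powR R _)).
exact: measurable_jacobi_weight.
Qed.

Lemma wnorm_ge0 p f : (1 <= p)%E -> (0 <= wnorm alpha p f)%E.
Proof. by move=> p1; rewrite wnorm_Lnorm// Lnorm_ge0. Qed.

Lemma wnormD p f g : (1 <= p)%E ->
  measurable_fun S (f : euclid R d -> R) -> measurable_fun S (g : euclid R d -> R) ->
  (wnorm alpha p (fun x => f x + g x)%R <= wnorm alpha p f + wnorm alpha p g)%E.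
Proof.
move=> p1 mf mg; rewrite !wnorm_Lnorm//.
have -> : EFin \o weighted p (fun x => f x + g x) =
    EFin \o (weighted p f \+ weighted p g).
  apply/funext => x; congr (_%:E); rewrite /weighted.
  by case: p p1 => [q||]// _ /=; rewrite !patchE; case: ifP => // _; rewrite ?addr0//= ?mulrDl.
by apply: eminkowski p1; exact: measurable_weighted.
Qed.

Lemma wnormZ p f (c : R) : (1 <= p)%E -> 0 < c ->
  measurable_fun S (f : euclid R d -> R) ->
  wnorm alpha p (fun x => c * f x) = (c%:E * wnorm alpha p f)%E.
Proof.
case: p => [q||]// q1 c0 mf; rewrite /wnorm.
  have q0 : 0 < q by rewrite (lt_le_trans ltr01).
  rewrite (eq_integral (fun x : euclid R d =>
    (c `^ q)%:E * (`|f x| `^ q * jacobi_weight alpha x)%:E)%E); last first.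
    move=> x _; rewrite normrM (gtr0_norm c0) powRM ?(ltW c0)// -EFinM.
    by rewrite -[in LHS]mulrA.
  rewrite (ge0_integralZl_EFin _ (@measurable_simplex R d)
    (fun x _ => powR_weight_ge0 q f x) (measurable_powR_weight q mf) (powR_ge0 _ _)).
  rewrite poweRM ?lee_fin ?powR_ge0//; last first.
    by apply: integral_ge0 => x _; exact: powR_weight_ge0.
  by rewrite poweR_EFin -powRrM mulfV ?gt_eqF// powRr1// ltW.
rewrite -ess_sup_pZl//; congr (ess_sup _ _); apply/funext => x /=.
rewrite !patchE; case: ifP => _; last by rewrite mule0.
by rewrite normrM gtr0_norm.
Qed.

Lemma wnormN p f : wnorm alpha p (fun x => - f x) = wnorm alpha p f.
Proof.
case: p => [q||]; rewrite /wnorm.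
- by under eq_integral do rewrite normrN.
- by congr (ess_sup _ (_ \_ _)); apply/funext => x; rewrite normrN.
- by [].
Qed.

Lemma ae_open_simplex : (0 < d)%N ->
  {ae mu, forall x : euclid R d, S x -> open_simplex x}.
Proof.
move=> d0; have [mN N0] := @boundary_hyperplanes_null R d d0.
exists boundary_hyperplanes; split => // x /= H.
have [Sx nU] : S x /\ ~ open_simplex x.
  by split; apply: contrapT => ?; apply: H => // ?; apply: contrapT.
move/simplexP : Sx => x0; apply: contrapT => nx; apply: nU => i.
by rewrite lt_neqAle x0 andbT eq_sym; apply/eqP => xi; apply: nx; exists i.
Qed.

(** Equality is required in the interior only, the boundary being negligible; the
    measurability of f is a consequence, the Lebesgue measure being complete. *)
Lemma wnorm_ae_eq p f g : (0 < d)%N ->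
  measurable_fun S (g : euclid R d -> R) ->
  (forall x, open_simplex x -> f x = g x) -> wnorm alpha p f = wnorm alpha p g.
Proof.
move=> d0 mg fg; have aeU := ae_open_simplex d0.
case: p => [q||]; rewrite /wnorm.
- apply: (congr1 (fun z => z `^ q^-1)%E).
  have mG := measurable_powR_weight q mg.
  have E : ae_eq mu S (fun x : euclid R d => (`|g x| `^ q * jacobi_weight alpha x)%:E)
     (fun x : euclid R d => (`|f x| `^ q * jacobi_weight alpha x)%:E).
    by apply: filterS aeU => x xU /xU {}xU; rewrite fg.
  apply/esym/(ge0_ae_eq_integral (@measurable_simplex R d) mG); last exact: E.
  + apply: ae_measurable_fun E mG.
    exact: measure_is_complete_caratheodory.
  + by move=> x _; exact: powR_weight_ge0.
  + by move=> x _; exact: powR_weight_ge0.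
- apply: eq_ess_sup; apply: filterS aeU => x xU.
  rewrite !patchE; case: ifPn => //; rewrite inE => /xU {}xU.
  by rewrite fg.
- by [].
Qed.

(** The weight has finite mass, and `|f| <= 1 + `|f| ^ q, or f is essentially bounded
    when p is infinite. *)
Lemma integrable_weighted_Lp p f : (0 < d)%N -> (forall i, -1 < alpha i) -> (1 <= p)%E ->
  weighted_Lp alpha p f ->
  mu.-integrable S (fun x : euclid R d => (f x * jacobi_weight alpha x)%:E).
Proof.
move=> d0 a1 p1 [mf flty].
have mS := @measurable_simplex R d.
have mw : measurable_fun S (jacobi_weight alpha : euclid R d -> R).
  by apply: measurable_funTS; exact: measurable_jacobi_weight.
have mfw : measurable_fun S (fun x : euclid R d => (f x * jacobi_weight alpha x)%:E).
  by apply/measurable_EFinP; exact: measurable_funM.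
have Iw : mu.-integrable S (fun x : euclid R d => (jacobi_weight alpha x)%:E).
  have := integrable_bmono_weight (fun=> 0%N) d0 a1.
  congr (integrable _ _ _); apply/funext => x.
  by rewrite /bmono big1 ?mul1r// => i _; rewrite expr0.
case: p p1 flty => [q||]//; last first.
  move=> _; rewrite /wnorm => flty.
  pose M := Num.max 0 (fine (ess_sup mu ((fun x => `|f x|%:E) \_ simplex))).
  have M0 : 0 <= M by rewrite /M le_max lexx.
  have fM : (ess_sup mu ((fun x => `|f x|%:E) \_ simplex) <= M%:E)%E.
    rewrite /M; move: flty; case: (ess_sup _ _) => [r| |]//= _.
      by rewrite lee_fin le_max lexx orbT.
    by rewrite leNye.
  have /ess_supP aeM := fM.
  apply/integrableP; split; first exact: mfw.
  apply: (@le_lt_trans _ _ (\int[mu]_(x in S) (M%:E * (jacobi_weight alpha x)%:E))%E).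
    apply: ae_ge0_le_integral.
    - exact: mS.
    - by move=> x _; exact: abse_ge0.
    - exact: measurableT_comp.
    - by move=> x _; rewrite mule_ge0 ?lee_fin ?jacobi_weight_ge0.
    - apply/measurable_EFinP; exact: measurable_funM.
    apply: filterS aeM => x; rewrite patchE => + Sx; rewrite mem_set// lee_fin => fxM.
    rewrite -EFinM lee_fin normrM (ger0_norm (jacobi_weight_ge0 _ _)).
    by rewrite ler_wpM2r ?jacobi_weight_ge0.
  have /integrableP[_] := integrableZl mS M Iw.
  rewrite (eq_integral (fun x : euclid R d => (M%:E * (jacobi_weight alpha x)%:E)%E))//.
  by move=> x _; rewrite gee0_abs// mule_ge0 ?lee_fin ?jacobi_weight_ge0.
rewrite lee_fin => q1; rewrite /wnorm => flty.
have q0 : 0 < q by rewrite (lt_le_trans ltr01).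
have Iq : mu.-integrable S (fun x : euclid R d => (`|f x| `^ q * jacobi_weight alpha x)%:E).
  apply/integrableP; split; first exact: measurable_powR_weight.
  rewrite (eq_integral (fun x : euclid R d => (`|f x| `^ q * jacobi_weight alpha x)%:E)).
    rewrite ltNge leye_eq; apply: contraTN flty => /eqP ->.
    by rewrite poweRyr// invr_neq0// gt_eqF.
  by move=> x _; rewrite gee0_abs//; exact: powR_weight_ge0.
apply: le_integrable (integrableD mS Iw Iq); [exact: mS|exact: mfw|].
move=> x _; rewrite /= lee_fin.
have w0 := jacobi_weight_ge0 alpha x; have p0 := powR_ge0 (`|f x|) q.
rewrite normrM (ger0_norm w0) [leRHS]ger0_norm; last first.
  exact: addr_ge0 w0 (mulr_ge0 p0 w0).
rewrite -[X in _ <= X + _]mul1r -mulrDl ler_wpM2r//.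
have [f1|f1] := leP (`|f x|) 1; first by rewrite (le_trans f1)// lerDl.
by rewrite (le_trans (le1r_powR (ltW f1) q1))// lerDr.
Qed.

End weighted_norm.

(** * Telescoping *)

Section linear_combinations.
Context {R : realType} {d : nat}.
Variable alpha : 'I_d.+1 -> R.
Local Notation S := (simplex : set (euclid R d)).
Implicit Types (c : nat -> R) (F : nat -> 'rV[R]_d -> R).

Definition lincomb (r : seq nat) c (s : nat -> seq (R * ('I_d.+1 -> nat))) :=
  flatten [seq [seq (c l * p.1, p.2) | p <- s l] | l <- r].

Lemma bpoly_lincomb r c s x :
  bpoly (lincomb r c s) x = \sum_(l <- r) c l * bpoly (s l) x.
Proof.
rewrite /bpoly /lincomb big_flatten big_map; apply: eq_bigr => l _.
by rewrite big_map mulr_sumr; apply: eq_bigr => p _; rewrite mulrA.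
Qed.

Lemma P_D_lincomb r c s x : open_simplex x ->
  P_D alpha (bpoly (lincomb r c s)) x = \sum_(l <- r) c l * P_D alpha (bpoly (s l)) x.
Proof.
move=> xU; rewrite P_D_bpoly// /lincomb big_flatten big_map; apply: eq_bigr => l _.
by rewrite P_D_bpoly// big_map mulr_sumr; apply: eq_bigr => p _; rewrite -mulrA.
Qed.

Lemma wnorm0 p : (1 <= p)%E -> wnorm alpha p (fun=> 0) = 0%E.
Proof.
move=> p1; rewrite wnorm_Lnorm//.
have -> : EFin \o weighted alpha p (fun=> 0) = cst 0%E.
  apply/funext => x; rewrite /weighted /=; congr (_%:E).
  by case: p p1 => [q||] _; rewrite patchE; case: ifP; rewrite // mul0r.
by apply: Lnorm0; rewrite gt_eqF// (lt_le_trans _ p1)// lte_fin.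
Qed.

Lemma wnorm_lincomb p (r : seq nat) c F : (1 <= p)%E ->
  (forall l, 0 < c l) -> (forall l, measurable_fun S (F l : euclid R d -> R)) ->
  (wnorm alpha p (fun x => \sum_(l <- r) c l * F l x)%R <=
   \sum_(l <- r) (c l)%:E * wnorm alpha p (F l))%E.
Proof.
move=> p1 c0 mF; elim: r => [|l r IH].
  by under eq_fun do rewrite big_nil; rewrite big_nil wnorm0.
under eq_fun do rewrite big_cons; rewrite big_cons.
have mcF k : measurable_fun S ((fun x => c k * F k x) : euclid R d -> R).
  by apply: measurable_funM => //; exact: mF.
have := @wnormD _ _ alpha p (fun x => c l * F l x)
  (fun x => \sum_(k <- r) c k * F k x) p1 (mcF l).
move=> /(_ _)/le_trans; apply.
  by apply: measurable_sum => k; exact: mcF.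
by rewrite wnormZ// leeD2l.
Qed.
End linear_combinations.

Section weights.
Context {R : realType}.
Variables (n : nat) (rho : R).
Hypotheses (n0 : (0 < n)%N) (rho1 : -1 < rho).

Definition eigen (k : nat) : R := k%:R * (k%:R + rho).

(** The constant C for which the weights C / (k (k + rho)), n < k <= 2n, sum to 1. *)
Definition norm_const : R := (\sum_(n <= l < 2 * n) (eigen l.+1)^-1)^-1.

Lemma eigen_gt0 k : 0 < eigen k.+1.
Proof.
rewrite mulr_gt0 ?ltr0n//; have : 0 <= k%:R :> R by [].
by rewrite -natr1; move: rho1; lra.
Qed.

Lemma norm_const_bounds : 0 < norm_const <= 2 * (2 * n%:R + rho).
Proof.
have n1 : 1 <= n%:R :> R by rewrite ler1n.
have e2 : (2 * n)%:R = 2 * n%:R :> R by rewrite natrM.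
have E0 : 0 < 2 * n%:R * (2 * n%:R + rho) by move: rho1; nra.
have T : (2 * (2 * n%:R + rho))^-1 <= \sum_(n <= l < 2 * n) (eigen l.+1)^-1.
  have -> : (2 * (2 * n%:R + rho))^-1 = \sum_(n <= l < 2 * n) (2 * n%:R * (2 * n%:R + rho))^-1.
    rewrite big_const_nat iter_addr_0 mul2n -addnn addnK -mulr_natl.
    by field; apply/andP; split; move: rho1; lra.
  rewrite !big_nat; apply: ler_sum => l /andP[nl l2].
  rewrite lef_pV2 ?posrE ?eigen_gt0// /eigen.
  have : l.+1%:R <= 2 * n%:R :> R by rewrite -e2 ler_nat.
  have : 1 <= l.+1%:R :> R by rewrite ler1n.
  by move: rho1; nra.
have P : 0 < (2 * (2 * n%:R + rho))^-1 by rewrite invr_gt0; move: rho1; lra.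
rewrite /norm_const invr_gt0 (lt_le_trans P T)/=.
by rewrite -[leRHS]invrK lef_pV2// posrE// (lt_le_trans P T).
Qed.

(** The bound on C reduces it to n (2n + rho) <= 2 k (k + rho), which holds from
    k = n + 1 on; for negative rho it fails at k = n. *)
Lemma weight_le l : (n <= l)%N -> norm_const / eigen l.+1 <= 4 / n%:R.
Proof.
move=> nl; have /andP[c0 cb] := norm_const_bounds.
have n1 : 1 <= n%:R :> R by rewrite ler1n.
have nk : n%:R + 1 <= l.+1%:R :> R by rewrite natr1 ler_nat.
have e0 := eigen_gt0 l.
rewrite ler_pdivrMr// mulrAC ler_pdivlMr; last by rewrite (lt_le_trans ltr01).
apply: le_trans (ler_wpM2r _ cb) _; first by rewrite (le_trans ler01).
rewrite /eigen; move: rho1 nk n1; move: (l.+1%:R : R) (n%:R : R) => k m r1 nk n1.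
have H : (m + 1) * (m + 1 + rho) <= k * (k + rho) by nra.
by nra.
Qed.

Lemma sum_weights : \sum_(n <= l < 2 * n) norm_const / eigen l.+1 = 1.
Proof.
rewrite -mulr_sumr /norm_const mulVf//.
by have /andP[+ _] := norm_const_bounds; rewrite invr_gt0 => /lt0r_neq0.
Qed.
End weights.

Theorem theorem1p1 (R : realType) (d : nat) (hd : (0 < d)%N)
    (p : \bar R) (hp : (1 <= p)%E)
    (alpha : 'I_d.+1 -> R) (halpha : forall i, -1 < alpha i)
    (f : 'rV[R]_d -> R) (hf : weighted_Lp alpha p f)
    (n : nat) (hn : (0 < n)%N) :
  let rho := d%:R + \sum_(i < d.+1) alpha i in
  let err k := wnorm alpha p (bernstein_durrmeyer alpha k f \- f)%R in
  (K_functional alpha p f n%:R^-1 <=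
   (4 + 2 * rho / n%:R)%:E * (err n + err (2 * n)%N) +
   (4 / n%:R)%:E * \sum_(n.+1 <= k < (2 * n).+1) err k)%E.
Proof.
pose r := d%:R + \sum_(i < d.+1) alpha i.
pose err k := wnorm alpha p (bernstein_durrmeyer alpha k f \- f)%R.
suff : (K_functional alpha p f n%:R^-1 <=
   (4 + 2 * r / n%:R)%:E * (err n + err (2 * n)%N) +
   (4 / n%:R)%:E * \sum_(n.+1 <= k < (2 * n).+1) err k)%E by [].
have [mf _] := hf; have If := integrable_weighted_Lp hd halpha hp hf.
have rE : r = rho alpha by [].
have r1 : -1 < r.
  have : 0 < \sum_(i < d.+1) (alpha i + 1).
    rewrite (bigD1 ord0)//= ltr_wpDr//; last by rewrite -ltrBlDr sub0r.
    by apply: sumr_ge0 => i _; rewrite ltW// -ltrBlDr sub0r.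
  by rewrite big_split/= sumr_const card_ord -natr1 /r; lra.
pose C := norm_const n r.
pose c l := C / eigen r l.+1.
have /andP[C0 Cb] : 0 < C <= 2 * (2 * n%:R + r) by exact: norm_const_bounds.
have c0 l : 0 < c l by rewrite divr_gt0 ?eigen_gt0.
pose M k := bernstein_durrmeyer alpha k f.
have ME k : M k = bpoly (bd_seq alpha f k) by exact: bernstein_durrmeyer_bpoly.
have mM k : measurable_fun ([set: euclid R d]) (M k : euclid R d -> R).
  by rewrite ME; apply: measurable_polyfun; exact: polyfun_bpoly.
have mS := @measurable_simplex R d.
have mMS k : measurable_fun (simplex : set (euclid R d)) (M k : euclid R d -> R).
  exact: measurable_funTS.
have me k : measurable_fun (simplex : set (euclid R d)) ((M k \- f) : euclid R d -> R).
  by apply: measurable_funB; [exact: mMS|exact: mf].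
pose g := bpoly (lincomb (index_iota n (2 * n)) c (fun l => bd_seq alpha f l.+1)).
have gE x : g x = \sum_(n <= l < 2 * n) c l * M l.+1 x.
  by rewrite /g bpoly_lincomb; apply: eq_bigr => l _; rewrite ME.
have Pg x : open_simplex x -> P_D alpha g x = C * (M n x - M (2 * n)%N x).
  move=> xU; rewrite /g P_D_lincomb//.
  transitivity (\sum_(n <= l < 2 * n) - C * (M l.+1 x - M l x)).
    apply: eq_bigr => l _.
    rewrite -bernstein_durrmeyer_bpoly// P_D_bernstein_durrmeyer//.
    rewrite /c /eigen -rE -/(M l) -/(M l.+1).
    have := eigen_gt0 r1 l; rewrite /eigen => /lt0r_neq0 e0.
    by rewrite mulrA -(mulrA C) mulVf// mulr1; ring.
  rewrite -mulr_sumr telescope_sumr; first by ring.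
  by rewrite mul2n -addnn leq_addr.
have n0 : 0 < n%:R :> R by rewrite ltr0n.
have err0 k : (0 <= err k)%E by exact: wnorm_ge0.
apply: (@le_trans _ _ (wnorm alpha p (f \- g)%R + (n%:R^-1)%:E * wnorm alpha p (P_D alpha g))%E).
  apply: ereal_inf_lbound; exists g => //.
  exact/C2_polyfun/polyfun_bpoly.
rewrite addeC; apply: leeD.
  have -> : wnorm alpha p (P_D alpha g) =
      (C%:E * wnorm alpha p (fun x => M n x - M (2 * n)%N x)%R)%E.
    have mB : measurable_fun (simplex : set (euclid R d))
        ((fun x => M n x - M (2 * n)%N x) : euclid R d -> R).
      by apply: measurable_funB; exact: mMS.
    have mCB : measurable_fun (simplex : set (euclid R d))
        ((fun x => C * (M n x - M (2 * n)%N x)) : euclid R d -> R).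
      by apply: measurable_funM; [exact: measurable_cst|exact: mB].
    by rewrite -(wnormZ alpha hp C0 mB); exact: wnorm_ae_eq hd mCB Pg.
  have T : (wnorm alpha p (fun x => M n x - M (2 * n)%N x)%R <= err n + err (2 * n)%N)%E.
    rewrite -[X in (_ <= _ + X)%E]wnormN.
    have -> : (fun x => M n x - M (2 * n)%N x) =
        (fun x => (M n \- f) x + - (M (2 * n)%N \- f) x).
      by apply/funext => x /=; ring.
    have mN : measurable_fun (simplex : set (euclid R d))
        ((fun x => - (M (2 * n)%N \- f) x) : euclid R d -> R).
      by apply: measurable_funN; exact: me.
    exact: (@wnormD _ _ alpha p (M n \- f) (fun x => - (M (2 * n)%N \- f) x)
      hp (me n) mN).
  rewrite muleA -EFinM.
  apply: (@le_trans _ _ ((n%:R^-1 * C)%:E * (err n + err (2 * n)%N))%E).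
    apply: lee_wpmul2l T; rewrite lee_fin; apply: mulr_ge0; last exact: ltW.
    by rewrite invr_ge0 ltW.
  apply: lee_wpmul2r; first exact: adde_ge0.
  rewrite lee_fin mulrC ler_pdivrMr//.
  have -> : (4 + 2 * r / n%:R) * n%:R = 4 * n%:R + 2 * r by field; rewrite gt_eqF.
  by move: Cb; lra.
rewrite big_add1 /= -(wnormN _ _ (f \- g)).
have -> : (fun x => - (f \- g) x) =
    (fun x => \sum_(n <= l < 2 * n) c l * (M l.+1 \- f) x).
  apply/funext => x /=; rewrite gE opprB.
  rewrite -[f x in LHS]mul1r -(sum_weights hn r1) mulr_suml -sumrB.
  by apply: eq_bigr => l _; rewrite mulrBr.
have := @wnorm_lincomb R d alpha p (index_iota n (2 * n)) c
  (fun l => (M l.+1 \- f)%R) hp c0 (fun l => me l.+1).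
move/le_trans; apply.
rewrite ge0_sume_distrr//= !big_nat; apply: lee_sum => l /andP[nl _].
apply: lee_wpmul2r; first exact: err0.
by rewrite lee_fin; exact: weight_le.
Qed.
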